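(* Let $d \geq 2$ be an integer and let $r>0$. Then: (i) $\lambda_c^{AB}(r) = \lambda_c(2r)$; and (ii) writing $\lambda_c = \lambda_c(2r)$, we have $$ \limsup_{\delta \downarrow 0} \left( \frac{\mu_c(r,\lambda_c + \delta)}{\delta^{-2d}\, |\log \delta|} \right) \leq \left(\frac{4 \lambda_c^2}{r}\right)^d d^{3d}(d+1)\, \pi_d . $$
   Context: $\|\cdot\|$ is the Euclidean norm on $\mathbb{R}^d$, and $\pi_d$ is the volume of the unit-radius ball in $\mathbb{R}^d$. For locally finite sets $\mathcal{X},\mathcal{Y}\subset\mathbb{R}^d$ and $r>0$, $G(\mathcal{X},\mathcal{Y},r)$ is the bipartite graph with vertex sets $\mathcal{X}$ and $\mathcal{Y}$, with an undirected edge $\{X,Y\}$ for each $X\in\mathcal{X}$, $Y\in\mathcal{Y}$ with $\|X-Y\|\le r$. Also $G(\mathcal{X},r)$ is the graph with vertex set $\mathcal{X}$ and an undirected edge $\{X,X'\}$ for each pair of (distinct) $X,X'\in\mathcal{X}$ with $\|X-X'\|\le r$. For $\lambda,\mu>0$, $\mathcal{P}_\lambda$ and $\mathcal{Q}_\mu$ are independent homogeneous Poisson point processes in $\mathbb{R}^d$ of intensity $\lambda$ and $\mu$ respectively, viewed as random subsets of $\mathbb{R}^d$. Let $\mathcal{I}$ be the class of graphs having at least one infinite (connected) component. Define, with the infimum of the empty set interpreted as $+\infty$, $$\mu_c(r,\lambda) := \inf\{\mu>0 : \mathbb{P}[G(\mathcal{P}_\lambda,\mathcal{Q}_\mu,r)\in\mathcal{I}]=1\},$$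 $$\lambda_c(2r) := \inf\{\lambda>0 : \mathbb{P}[G(\mathcal{P}_\lambda,2r)\in\mathcal{I}]=1\},$$ $$\lambda_c^{AB}(r) := \inf\{\lambda>0 : \mu_c(r,\lambda)<\infty\}.$$ *)

(* Defs.v *)
From HB Require Import structures.
From mathcomp Require Import all_boot all_order all_algebra.
From mathcomp Require Import all_classical all_reals all_analysis.

Set Implicit Arguments.
Unset Strict Implicit.
Unset Printing Implicit Defensive.

Import Order.TTheory GRing.Theory Num.Theory.
Import numFieldNormedType.Exports.

Local Open Scope classical_set_scope.
Local Open Scope card_scope.
Local Open Scope ring_scope.

Section EuclideanSpace.
Context {R : realType} {d : nat}.
Implicit Types (x a b : 'rV[R]_d) (A : set 'rV[R]_d).

(* The library norm on matrices is the sup norm. *)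
Definition enorm x : R := Num.sqrt (\sum_(i < d) (x ord0 i) ^+ 2).

Definition box a b : set 'rV[R]_d :=
  [set x | forall i, a ord0 i <= x ord0 i <= b ord0 i].

Definition box_volume a b : R := \prod_(i < d) (b ord0 i - a ord0 i).

Definition box_cover A (ab : nat -> 'rV[R]_d * 'rV[R]_d) : Prop :=
  (forall k i, (ab k).1 ord0 i <= (ab k).2 ord0 i) /\
  A `<=` \bigcup_k box (ab k).1 (ab k).2.

(* Lebesgue outer measure on R^d, which is Lebesgue measure on Borel sets. *)
Definition volume A : \bar R :=
  ereal_inf [set (\sum_(0 <= k <oo) (box_volume (ab k).1 (ab k).2)%:E)%E
            | ab in box_cover A].

Definition unit_ball_volume : R := fine (volume [set x | enorm x <= 1]).

Definition bounded_borel : set (set 'rV[R]_d) :=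
  [set A | <<s @open 'rV[R]_d >> A /\ bounded_set A].

Definition locally_finite A : Prop :=
  forall B : set 'rV[R]_d, bounded_set B -> finite_set (A `&` B).

End EuclideanSpace.

Arguments unit_ball_volume R d : clear implicits.

Section PointProcess.
Context {R : realType} {d : nat} {dO : measure_display}
  {Omega : measurableType dO}.
Implicit Types (Pr : probability Omega R) (N : Omega -> set 'rV[R]_d).

Definition count_event N (A : set 'rV[R]_d) (n : nat) : set Omega :=
  [set w | (N w `&` A) #= `I_n].

(* [poisson_prob] is Poisson(m) for m > 0 and the Dirac mass at 0 for m = 0,
   whereas [poisson_pmf] is not a probability mass function at rate 0; the
   nat argument of [poisson_prob] is unused by the library. *)
Record poisson_process Pr (lam : R) N : Prop := {
  pp_locally_finite : forall w, locally_finite (N w) ;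
  pp_measurable : forall A n, bounded_borel A -> measurable (count_event N A n) ;
  pp_poisson : forall A n, bounded_borel A ->
    Pr (count_event N A n) = poisson_prob (lam * fine (volume A)) 0 [set n] ;
  pp_indep : forall k (A : 'I_k -> set 'rV[R]_d) (n : 'I_k -> nat),
    (forall i, bounded_borel (A i)) -> trivIset setT A ->
    Pr (\bigcap_i count_event N (A i) (n i)) =
    (\prod_(i < k) Pr (count_event N (A i) (n i)))%E }.

Definition process_sigma_algebra N : set (set Omega) :=
  <<s [set count_event N A n | A in bounded_borel & n in [set: nat]] >>.

Definition independent_processes Pr N N' : Prop :=
  forall E F, process_sigma_algebra N E -> process_sigma_algebra N' F ->
    Pr (E `&` F) = (Pr E * Pr F)%E.

End PointProcess.

Record graph (T : Type) := Graph {
  vertices : set T ;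
  adjacent : T -> T -> Prop }.

Definition component T (G : graph T) (x : T) : set T :=
  [set y | exists2 p, path (fun u v => `[< adjacent G u v >]) x p
                    & last x p = y].

Definition has_infinite_component T (G : graph T) : Prop :=
  exists2 x, vertices G x & infinite_set (component G x).

Section GeometricGraphs.
Context {R : realType} {d : nat}.
Implicit Types (X Y : set 'rV[R]_d) (r : R).

Definition geometric_graph X r : graph 'rV[R]_d :=
  Graph X (fun x y => [/\ X x, X y, x <> y & enorm (x - y) <= r]).

(* The two classes of the bipartition are kept apart by a sum type, even if the
   sets X and Y happen to meet. *)
Definition bipartite_geometric_graph X Y r : graph ('rV[R]_d + 'rV[R]_d) :=
  Graph
    [set u | match u with inl x => X x | inr y => Y y end]
    (fun u v => match u, v with
     | inl x, inr y | inr y, inl x => [/\ X x, Y y & enorm (x - y) <= r]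
     | _, _ => False
     end).

End GeometricGraphs.

Section CriticalValues.
Context {R : realType} {d : nat} {dO : measure_display}
  {Omega : measurableType dO}.
Implicit Types (Pr : probability Omega R) (P Q : R -> Omega -> set 'rV[R]_d).

Definition mu_c Pr P Q (r lam : R) : \bar R :=
  ereal_inf [set mu%:E | mu in [set mu : R | 0 < mu /\
    {ae Pr, forall w, has_infinite_component
                        (bipartite_geometric_graph (P lam w) (Q mu w) r)}]].

Definition lambda_c Pr P (s : R) : \bar R :=
  ereal_inf [set lam%:E | lam in [set lam : R | 0 < lam /\
    {ae Pr, forall w, has_infinite_component (geometric_graph (P lam w) s)}]].

Definition lambda_c_AB Pr P Q (r : R) : \bar R :=
  ereal_inf [set lam%:E | lam in [set lam : R | 0 < lam /\
    (mu_c Pr P Q r lam < +oo)%E]].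

End CriticalValues.

(* Main.v *)
Require Import Defs.
From HB Require Import structures.
From mathcomp Require Import all_boot all_order all_algebra.
From mathcomp Require Import all_classical all_reals all_analysis.
From mathcomp Require Import measurable_realfun.
From mathcomp Require Import zify ring lra.
Import Order.TTheory GRing.Theory Num.Theory.
Import numFieldNormedType.Exports.
Local Open Scope classical_set_scope.
Local Open Scope ring_scope.

Set Implicit Arguments.
Unset Strict Implicit.
Unset Printing Implicit Defensive.

(* The upper bound is obtained with a quotient tending to 0. Suppose that
   P_lam' percolates at range 2r, with lam' < lam = lam_c + delta. Cut space into
   cubes, of side a for P_lam' and of slightly smaller side eps for P_lam, with
   lam' a^d < lam eps^d, so that a cube is occupied with probability p' < p. If
   two cubes of side a contain points at distance at most 2r, then all points of
   the corresponding cubes of side eps are within r of the points of one common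
   small cube near their midpoint. Group the cubes into blocks of side of
   order r and reserve for each block its own small cubes; a block whose reserved
   cubes do not all contain points of Q_mu is erased. Blocks are then
   erased independently, with probability at most e if mu is of order
   eps^-d |log delta|. A random subset of density p erased with probability e
   dominates one of density p' as soon as e is at most
   (probability that a block is empty) * (1 - p'/p), which is of order delta and
   not delta^(number of cubes). Only finitely many cubes matter for the
   existence of a path of given length from a given box, so all comparisons
   concern finite families of independent events.

   That lam_c is finite is proved by renormalization: a block of scale k + 1 is
   good if at most one of its 3 x 3 subblocks of scale k is not, and the good
   parts of neighbouring good blocks are automatically connected. *)

(** * Increasing functions of random subsets *)

Section RandomSubset.
Context {R : realFieldType} {T : Type}.
Implicit Types (pr : T -> R) (s t U : seq T) (f : seq T -> R).

(** Expectation of [f] under the Bernoulli product measure: each [i] of [s] is kept independently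
    with probability [pr i]. The recursion keeps the domination arguments finite and algebraic. *)
Fixpoint subset_mean pr s f : R :=
  if s is i :: s' then
    pr i * subset_mean pr s' (fun U => f (i :: U)) + (1 - pr i) * subset_mean pr s' f
  else f [::].

Lemma subset_mean_cat pr s t f :
  subset_mean pr (s ++ t) f =
  subset_mean pr s (fun U => subset_mean pr t (fun V => f (U ++ V))).
Proof. by elim: s f => [//|i s IH] f /=; rewrite !IH. Qed.

Lemma le_subset_mean_in (a : pred T) pr s f g : (forall i, 0 <= pr i <= 1) ->
  all a s -> (forall U, all a U -> f U <= g U) ->
  subset_mean pr s f <= subset_mean pr s g.
Proof.
move=> p01; elim: s f g => [|i s IH] f g /= => [_ fg|/andP[ai als] fg]; first exact: fg.
have /andP[p0 p1] := p01 i.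
rewrite lerD// ler_wpM2l ?subr_ge0// IH// => U alU; apply: fg => //=.
by rewrite ai.
Qed.

Lemma le_subset_mean pr s f g : (forall i, 0 <= pr i <= 1) ->
  (forall U, f U <= g U) -> subset_mean pr s f <= subset_mean pr s g.
Proof.
by move=> p01 fg; apply: (@le_subset_mean_in predT) => //; exact: all_predT.
Qed.

Lemma subset_mean_cst pr s c : subset_mean pr s (fun=> c) = c.
Proof. by elim: s => [//|i s /= ->]; ring. Qed.

End RandomSubset.

Lemma subset_mean_map {R : realFieldType} {S T : Type} (h : S -> T) (pr : T -> R) s f :
  subset_mean pr (map h s) f = subset_mean (pr \o h) s (f \o map h).
Proof. by elim: s f => [//|i s IH] f /=; rewrite !IH. Qed.

Section Domination.
Context {R : realFieldType} {I B : eqType}.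
Implicit Types (f : seq I -> R) (s U V : seq I).

(** Inclusion is tested on elements, so an increasing function ignores order and repetitions: lists
    serve as finite sets. *)
Definition increasing f := forall U V, {subset U <= V} -> f U <= f V.

Lemma increasing_catr f U : increasing f -> increasing (fun V => f (U ++ V)).
Proof.
move=> incf V W VW; apply: incf => x; rewrite !mem_cat => /orP[->//|/VW ->].
by rewrite orbT.
Qed.

Lemma increasing_catl f U : increasing f -> increasing (fun V => f (V ++ U)).
Proof.
move=> incf V W VW; apply: incf => x; rewrite !mem_cat => /orP[/VW->//|->].
by rewrite orbT.
Qed.

Lemma increasing_subset_mean (p : R) s (g : seq I -> seq I -> R) : 0 <= p <= 1 ->
  (forall V, increasing (g^~ V)) -> increasing (fun U => subset_mean (fun=> p) s (g U)).
Proof. by move=> p01 incg U V UV; apply: le_subset_mean => // W; exact: incg. Qed.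

Lemma subset_mean_ge0r (p : R) s f : 0 <= p <= 1 -> increasing f ->
  f [::] <= subset_mean (fun=> p) s f.
Proof.
move=> p01 incf; rewrite -[leLHS](subset_mean_cst (fun=> p) s).
by apply: le_subset_mean => // U; exact: incf.
Qed.

(* The admissible [e] is linear in [p - p'], and not of order
   [(p - p') ^+ size s]: this allows blocks of many cubes. *)
Lemma subset_mean_erase (p p' e : R) s f : 0 <= p' -> p' < p -> p <= 1 ->
  e <= (1 - p') ^+ size s * (1 - p' / p) -> increasing f ->
  subset_mean (fun=> p') s f <= (1 - e) * subset_mean (fun=> p) s f + e * f [::].
Proof.
move=> p'0 p'p p1 le_e incf.
have p0 : 0 < p by exact: le_lt_trans p'p.
have p01 : 0 <= p <= 1 by rewrite ltW.
set a := 1 - p' / p.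
have a01 : 0 <= a <= 1.
  by rewrite subr_ge0 ler_pdivrMr// mul1r ltW//= gerBl divr_ge0// ltW.
(* The right-hand side is nonincreasing in [e], because [f [::]] is at most the mean of [f]; hence
   only the largest admissible [e] matters. *)
suff: subset_mean (fun=> p') s f <=
    (1 - (1 - p') ^+ size s * a) * subset_mean (fun=> p) s f
    + (1 - p') ^+ size s * a * f [::].
  have := subset_mean_ge0r s p01 incf.
  set X := subset_mean _ _ _ => fX; move/le_trans; apply.
  set k := _ * a in le_e *; have -> : (1 - e) * X + e * f [::] =
    (1 - k) * X + k * f [::] + (k - e) * (X - f [::]) by ring.
  by rewrite lerDl mulr_ge0// subr_ge0.
elim: s f incf {le_e} => [|i s IH] f incf /=; first lra.
have inc1 : increasing (fun U => f (i :: U)) by exact: (@increasing_catr f [:: i]).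
have := IH _ inc1; have := IH _ incf.
have := subset_mean_ge0r s p01 incf.
have := subset_mean_ge0r s p01 inc1.
have le01 : subset_mean (fun=> p) s f <= subset_mean (fun=> p) s (fun U => f (i :: U)).
  by apply: le_subset_mean => // U; apply: incf => x xU; rewrite inE xU orbT.
rewrite exprS.
set k := (1 - p') ^+ size s.
have k01 : 0 <= k <= 1 by rewrite exprn_ge0 ?exprn_ile1 ?gerBl//; lra.
move: le01; set X0 := subset_mean _ _ _; set X1 := subset_mean _ _ _.
set Y0 := subset_mean _ _ _; set Y1 := subset_mean _ _ _ => le01 c1 c0 h0 h1.
have ka01 : 0 <= k * a <= 1 by nra.
have pa : p * a = p - p' by rewrite /a; field; lra.
have h1' : Y1 <= X1 by nra.
have h2 : p' * Y1 <= p' * X1 by rewrite ler_wpM2l.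
have h3 : (1 - p') * Y0 <= (1 - p') * ((1 - k * a) * X0 + k * a * f [::]).
  by apply: ler_wpM2l => //; lra.
(* With the first site open, only [Y1 <= X1] is kept; the erasure is charged to the branch where
   that site is closed. The slack left over is exactly this multiple of [X1 - X0]. *)
have H : 0 <= p * a * (1 - (1 - p') * k) * (X1 - X0).
  by apply: mulr_ge0; [apply: mulr_ge0; nra | lra].
apply: le_trans (lerD h2 h3) _; rewrite -subr_ge0.
rewrite [leRHS](_ : _ = p * a * (1 - (1 - p') * k) * (X1 - X0))//.
have -> : p' = p - p * a by rewrite pa opprB addrC subrK.
by move: X0 X1 k a c0 c1 {h0 h1 h1' h2 h3 H ka01 k01 a01 pa le01 IH Y0 Y1} => *; ring.
Qed.
End Domination.

Section BlockDomination.
Context {R : realFieldType} {I B : eqType} (blk : I -> B).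

(** An entry [inr b] means that the block [b] is not erased. Sites and erasures form one random
    list, so that a single product measure governs both. *)
Definition surviving (U : seq (I + B)) : seq I :=
  pmap (fun x => if x is inl z then
                   if inr (blk z) \in U then Some z else None
                 else None) U.

Lemma mem_surviving U z : (z \in surviving U) = (inl z \in U) && (inr (blk z) \in U).
Proof.
rewrite mem_pmap; apply/mapP/andP => [[[y|//] yU]|[zU bU]].
  by case: ifP => // bU [->].
by exists (inl z) => //; rewrite bU.
Qed.

(** An inclusion only: a block marker in one part may save sites of the other. Increasing functions
    ask for no more. *)
Lemma surviving_cat U V z :
  z \in surviving U ++ surviving V -> z \in surviving (U ++ V).
Proof.
by rewrite mem_cat !mem_surviving !mem_cat => /orP[]/andP[-> ->]; rewrite ?orbT.
Qed.

Definition with_blocks (sites : B -> seq I) (bs : seq B) : seq (I + B) :=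
  flatten [seq inr b :: map inl (sites b) | b <- bs].

(** Induction on the blocks. The mean [h] over the later blocks is an increasing function of the
    sites drawn in the first block, so [subset_mean_erase] applies to that block alone. *)
Lemma subset_mean_blocks (p p' : R) (g : B -> R) (sites : B -> seq I) bs (f : seq I -> R) :
  0 <= p' -> p' < p -> p <= 1 -> (forall b, 0 <= g b <= 1) ->
  (forall b z, z \in sites b -> blk z = b) ->
  (forall b, 1 - g b <= (1 - p') ^+ size (sites b) * (1 - p' / p)) ->
  increasing f ->
  subset_mean (fun=> p') (flatten (map sites bs)) f <=
  subset_mean (fun x => match x with inl _ => p | inr b => g b end)
    (with_blocks sites bs) (f \o surviving).
Proof.
move=> p'0 p'p p1 g01 sitesb g_ge.
set pr := fun x : I + B => _.
have pr01 x : 0 <= pr x <= 1.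
  by case: x => //= _; rewrite p1 andbT ltW//; exact: le_lt_trans p'p.
have p'01 : 0 <= p' <= 1 by rewrite p'0 ltW//; exact: lt_le_trans p1.
elim: bs f => [//|b bs IH] f incf.
have -> : with_blocks sites (b :: bs) =
  (inr b :: map inl (sites b)) ++ with_blocks sites bs by [].
rewrite [map sites _]/= [flatten _]/= !subset_mean_cat.
pose h U := subset_mean (fun=> p') (flatten (map sites bs)) (fun V => f (U ++ V)).
have inch : increasing h.
  by apply: increasing_subset_mean => // V; exact: increasing_catl.
apply: le_trans (_ : subset_mean pr (inr b :: map inl (sites b)) (h \o surviving) <= _).
  rewrite /=.
  have := subset_mean_erase p'0 p'p p1 (g_ge b) inch; rewrite subKr => /le_trans; apply.
  have gb01 := g01 b.
  apply: lerD; last first.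
    apply: ler_wpM2l; first by move/andP: gb01; lra.
    rewrite -[leLHS](subset_mean_cst pr (map inl (sites b))).
    by apply: le_subset_mean => // U; exact: inch.
  apply: ler_wpM2l; first by case/andP: gb01.
  (* All sites drawn here come from [sites b], so the marker [inr b] keeps every one of them. *)
  rewrite subset_mean_map; apply: (@le_subset_mean_in _ _ (fun z => blk z == b)).
  - by move=> _ /=; rewrite p1 andbT ltW//; exact: le_lt_trans p'p.
  - by apply/allP => z /sitesb ->.
  - move=> U /allP Ub /=; apply: inch => z zU.
    rewrite (@mem_surviving (inr b :: map inl U)) !inE/= map_f//=.
    by rewrite (eqP (Ub _ zU)) eqxx.
apply: le_subset_mean => // U.
apply: le_trans (IH _ (increasing_catr _ incf)) _.
by apply: le_subset_mean => // V; apply: incf; exact: surviving_cat.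
Qed.
End BlockDomination.

(** * Independent events *)

Section IndependentEvents.
Context {R : realType} {dO : measure_display} {Omega : measurableType dO}
  (Pr : probability Omega R).
Implicit Types (A H : set Omega).

Lemma probability_split A H (x y : R) : measurable A -> measurable H ->
  Pr A = x%:E -> Pr (A `&` H) = y%:E -> Pr (A `&` ~` H) = (x - y)%:E.
Proof.
move=> mA mH Ax AHy.
by rewrite -setDE measureD//= ?Ax// ?ltry// AHy.
Qed.

Section Family.
Context {T : choiceType}.
Implicit Types (Ev : T -> set Omega) (pr : T -> R) (s t : seq T).

Definition all_occur Ev s : set Omega := [set w | forall i, i \in s -> Ev i w].

Definition independent_events Ev pr : Prop :=
  (forall i, measurable (Ev i)) /\
  forall s, uniq s -> Pr (all_occur Ev s) = (\prod_(i <- s) pr i)%:E.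

Definition occurring Ev s (w : Omega) : seq T := [seq i <- s | `[< Ev i w >]].

Lemma all_occur_cons Ev i s : all_occur Ev (i :: s) = Ev i `&` all_occur Ev s.
Proof.
apply/seteqP; split => w.
  by move=> H; split=> [|j js]; apply: H; rewrite inE ?eqxx// js orbT.
by move=> [wi ws] j; rewrite inE => /orP[/eqP->//|/ws].
Qed.

Lemma measurable_all_occur Ev s : (forall i, measurable (Ev i)) -> measurable (all_occur Ev s).
Proof.
move=> mEv; elim: s => [|i s IH]; last by rewrite all_occur_cons; exact: measurableI.
by rewrite (_ : all_occur _ _ = setT)//; apply/seteqP; split.
Qed.

Lemma occurring_cons Ev i s (f : seq T -> bool) :
  [set w | f (occurring Ev (i :: s) w)] =
  (Ev i `&` [set w | f (i :: occurring Ev s w)]) `|`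
  (~` Ev i `&` [set w | f (occurring Ev s w)]).
Proof.
apply/seteqP; split => w; rewrite /occurring /=.
  by case: asboolP => Ew fw; [left | right].
by move=> [[Ew fw]|[Ew fw]]; case: asboolP.
Qed.

Lemma measurable_occurring Ev s (f : seq T -> bool) : (forall i, measurable (Ev i)) ->
  measurable [set w | f (occurring Ev s w)].
Proof.
move=> mEv; elim: s f => [|i s IH] f.
  rewrite /occurring /=; case: (f [::]).
    by rewrite (_ : [set _ | _] = setT)//; apply/seteqP; split.
  by rewrite (_ : [set _ | _] = set0)//; apply/seteqP; split.
rewrite occurring_cons; apply: measurableU; apply: measurableI => //.
- exact: (IH (fun U => f (i :: U))).
- exact: measurableC.
Qed.

Lemma probability_occurring Ev pr s (f : seq T -> bool) :
  independent_events Ev pr -> uniq s ->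
  Pr [set w | f (occurring Ev s w)] =
  (subset_mean pr s (fun U => (f U)%:R))%:E.
Proof.
move=> [mEv indEv] us.
(* The induction needs an auxiliary event [H] of probability [c], which accumulates the outcomes of
   the sites already treated. *)
suff: forall H (c : R), measurable H ->
    (forall t, uniq t -> {subset t <= s} ->
       Pr (H `&` all_occur Ev t) = (c * \prod_(i <- t) pr i)%:E) ->
    Pr (H `&` [set w | f (occurring Ev s w)]) =
    (c * subset_mean pr s (fun U => (f U)%:R))%:E.
  move=> /(_ setT 1); rewrite !setTI mul1r; apply=> // t ut _.
  by rewrite setTI indEv// mul1r.
elim: s f us => [|i s IH] f us H c mH Ht.
  have := Ht [::] isT (fun _ => id); rewrite big_nil mulr1.
  rewrite (_ : all_occur _ _ = setT); last by apply/seteqP; split.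
  rewrite setIT /occurring /= => Hc; case: (f [::]).
    by rewrite (_ : [set _ | _] = setT) ?setIT ?mulr1//; apply/seteqP; split.
  by rewrite (_ : [set _ | _] = set0) ?setI0 ?measure0 ?mulr0//; apply/seteqP; split.
move: us => /= /andP[iNs us].
have Hi t : uniq t -> {subset t <= s} ->
    Pr (H `&` Ev i `&` all_occur Ev t) = (c * pr i * \prod_(j <- t) pr j)%:E.
  move=> ut ts; rewrite -setIA -all_occur_cons Ht//=.
  - by rewrite big_cons mulrA.
  - by rewrite ut andbT; apply: contra iNs => /ts.
  - by move=> j; rewrite !inE => /orP[->//|/ts ->]; rewrite orbT.
have Hni t : uniq t -> {subset t <= s} ->
    Pr (H `&` ~` Ev i `&` all_occur Ev t) = (c * (1 - pr i) * \prod_(j <- t) pr j)%:E.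
  move=> ut ts; rewrite setIAC; have mt := measurable_all_occur t mEv.
  have /(probability_split (measurableI _ _ mH mt) (mEv i)) : Pr (H `&` all_occur Ev t) =
      (c * \prod_(j <- t) pr j)%:E.
    by apply: Ht => // j /ts; rewrite inE orbC => ->.
  move=> /(_ (c * pr i * \prod_(j <- t) pr j)) ->; last by rewrite setIAC Hi.
  by congr (_%:E); ring.
rewrite occurring_cons setIUr !setIA measureU/=.
- rewrite (IH (fun U => f (i :: U)) us _ _ _ Hi); last exact: measurableI.
  rewrite (IH f us _ _ _ Hni); last by apply: measurableI => //; exact: measurableC.
  by rewrite -EFinD; congr (_%:E); ring.
- apply: measurableI; first exact: measurableI.
  exact: (measurable_occurring s (fun U => f (i :: U))).
- apply: measurableI; last exact: measurable_occurring.
  by apply: measurableI => //; exact: measurableC.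
- by apply/seteqP; split => // w [[[_ wi] _] [[_ nwi] _]]; exact: nwi.
Qed.

(** The event that nothing in [s] occurs is a function of [occurring Ev s], and its subset mean is
    the product of the [1 - pr i]. *)
Lemma independent_events_setC Ev pr : independent_events Ev pr ->
  independent_events (fun i => ~` Ev i) (fun i => 1 - pr i).
Proof.
move=> indEv; have [mEv _] := indEv.
split=> [i|s us]; first exact: measurableC.
have -> : all_occur (fun i => ~` Ev i) s = [set w | nilp (occurring Ev s w)].
  apply/seteqP; split => w /=.
    move=> Hw; rewrite /nilp size_filter -leqn0 leqNgt -has_count; apply/hasPn => i /Hw nE.
    by apply/asboolP.
  rewrite /nilp size_filter -leqn0 leqNgt -has_count => /hasPn Hw i /Hw /asboolP.
  exact.
rewrite (probability_occurring _ indEv us); congr (_%:E).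
have mean0 t : subset_mean pr t (fun U => 0) = 0 by exact: subset_mean_cst.
elim: s {us} => [|i s IH]; first by rewrite big_nil.
by rewrite big_cons /= IH mean0 mulr0 add0r.
Qed.

End Family.

End IndependentEvents.

(** * Volume of cubes *)

Section CubeVolume.
Context {R : realType}.

(* Induction on the dimension: integrate the covering inequality in the last
   coordinate, the boxes met by a slice being weighted by the indicator of that
   coordinate. *)
Lemma weighted_cover_volume (a : R) d (v : nat -> R) (l u : nat -> nat -> R) (c : nat -> R) :
  0 < a -> (forall k i, l k i <= u k i) -> (forall k, 0 <= c k) ->
  (forall x : nat -> R, (forall i, v i <= x i < v i + a) ->
     (1 <= \sum_(0 <= k <oo) (c k * \prod_(i < d) \1_(`[l k i, u k i]) (x i))%:E)%E) ->
  ((a ^+ d)%:E <= \sum_(0 <= k <oo) (c k * \prod_(i < d) (u k i - l k i))%:E)%E.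
Proof.
move=> ap; have a0 := ltW ap; elim: d c => [|d IH] c lu c0 cov.
  have /cov : forall i, v i <= v i < v i + a by move=> i; rewrite lexx ltrDl.
  rewrite expr0 => /le_trans; apply.
  by apply: lee_nneseries => [k _ _|k _]; rewrite !big_ord0 ?lee_fin ?mulr1.
have slice t : v d <= t < v d + a -> ((a ^+ d)%:E <=
    \sum_(0 <= k <oo) ((c k * \prod_(i < d) (u k i - l k i)) * \1_(`[l k d, u k d]) t)%:E)%E.
  move=> tv.
  have := IH (fun k => c k * \1_(`[l k d, u k d]) t).
  under [X in _ -> _ -> _ -> (_ <= X)%E]eq_eseriesr do rewrite mulrAC.
  apply=> // [k|x xv]; first by rewrite mulr_ge0// indicE.
  have := cov (fun i => if i == d then t else x i).
  set s := (X in (_ <= X)%E); set s' := (X in _ -> (_ <= X)%E).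
  have -> : s = s'.
    apply: eq_eseriesr => k _; rewrite big_ord_recr/= eqxx mulrAC -mulrA.
    congr (_ * (_ * _))%:E; apply: eq_bigr => i _.
    by rewrite ltn_eqF.
  by apply=> i; case: eqP => [->|].
pose D : set (measurableTypeR R) := [set` `[v d, v d + a[].
have mD : measurable D by exact: measurable_itv.
have volD : lebesgue_measure D = a%:E.
  by rewrite lebesgue_measure_itv/= lte_fin ltrDl ap -EFinB addrAC subrr add0r.
pose f k (t : measurableTypeR R) : \bar R :=
  ((c k * \prod_(i < d) (u k i - l k i)) * \1_(`[l k d, u k d]) t)%:E.
have m1 k : measurable_fun D (f k).
  by apply/measurable_EFinP; exact: measurable_funM.
have p0 k : 0 <= c k * \prod_(i < d) (u k i - l k i).
  by rewrite mulr_ge0// prodr_ge0// => i _; rewrite subr_ge0.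
have g0 k t : (0 <= f k t)%E.
  by rewrite lee_fin mulr_ge0// indicE.
rewrite exprSr EFinM -volD -integral_cst//.
apply: (@le_trans _ _ (\int[lebesgue_measure]_(t in D)
    \sum_(0 <= k <oo) f k t)%E).
  apply: ge0_le_integral => //.
  - by move=> t _; rewrite lee_fin exprn_ge0.
  - exact: ge0_emeasurable_sum.
rewrite integral_nneseries//; apply: lee_nneseries => [k _ _|k _].
  exact: integral_ge0.
rewrite (@integralZl_indic _ _ _ _ _ mD (fun=> [set` `[l k d, u k d]]))//; last by rewrite ltNge p0.
rewrite integral_indic//.
rewrite big_ord_recr/= mulrA [leRHS]EFinM; apply: lee_wpmul2l; first by rewrite lee_fin.
apply: (@le_trans _ _ (lebesgue_measure ([set` `[l k d, u k d]] : set (measurableTypeR R)))).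
  apply: le_measure; last exact: subIsetl.
    by rewrite inE; apply: measurableI => //; exact: measurable_itv.
  by rewrite inE; exact: measurable_itv.
rewrite lebesgue_measure_itv/= lte_fin; case: ifPn; first by rewrite EFinB.
by rewrite lee_fin subr_ge0.
Qed.

Context {d : nat}.
Implicit Types (z : {ffun 'I_d -> int}) (x : 'rV[R]_d).

Definition cube (a : R) z : set 'rV[R]_d :=
  [set x | forall i, a * (z i)%:~R <= x ord0 i < a * (z i)%:~R + a].

(** Upper bound: one closed box, padded with boxes of volume 0. Lower bound: [weighted_cover_volume]
    with unit weights, as a box containing the point already contributes 1 to the sum of
    indicators. *)
Lemma volume_cube (a : R) z : (0 < d)%N -> 0 < a -> volume (cube a z) = (a ^+ d)%:E.
Proof.
move=> d0 a0; apply/eqP; rewrite eq_le; apply/andP; split.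
  apply: ereal_inf_lbound => /=.
  pose lo : 'rV[R]_d := \row_i (a * (z i)%:~R).
  exists (fun k : nat => if k == 0%N then (lo, lo + const_mx a) else (0, 0)).
    split=> [k i|x xz]; first by case: eqP => //= _; rewrite !mxE lerDl ltW.
    exists 0%N => // i /=; rewrite !mxE; have /andP[-> /ltW] := xz i.
    by rewrite addrC.
  rewrite (@nneseriesD1 _ _ 0%N)//=; last first.
    move=> k _; rewrite lee_fin /box_volume prodr_ge0// => i _.
    by case: eqP => /= _; rewrite !mxE ?subrr// addrAC subrr add0r ltW.
  rewrite eseries0 ?adde0 /box_volume/=; last first.
    move=> k _ /negbTE -> /=; congr (_%:E).
    by apply/eqP/prodf_eq0; exists (Ordinal d0) => //=; rewrite !mxE subrr.
  congr (_%:E); under eq_bigr do rewrite !mxE addrAC subrr add0r.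
  by rewrite prodr_const card_ord.
apply: le_ereal_inf_tmp => _ [ab [lu cov] <-].
(* The covering lemma indexes coordinates by all of [nat]; those beyond [d] get the default value
   0. *)
pose nth_or0 (v : 'rV[R]_d) (i : nat) : R :=
  if insub i is Some j then v ord0 j else 0.
have nth_ord v (j : 'I_d) : nth_or0 v j = v ord0 j.
  by rewrite /nth_or0 insubT// => lt_j; congr (v _ _); exact: val_inj.
have := @weighted_cover_volume a d (nth_or0 (\row_i (a * (z i)%:~R)))
  (fun k => nth_or0 (ab k).1) (fun k => nth_or0 (ab k).2) (fun=> 1) a0.
under [X in _ -> _ -> _ -> (_ <= X)%E]eq_eseriesr => k _.
  rewrite mul1r; under eq_bigr do rewrite !nth_ord.
  over.
apply=> // [k i|x xv].
  by rewrite /nth_or0; case: insubP => [j _ _|_] //; exact: lu.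
have [k _ xk] : (\bigcup_k box (ab k).1 (ab k).2) (\row_i x i).
  apply: cov => i; have := xv i; rewrite nth_ord !mxE; exact.
rewrite (@nneseriesD1 _ _ k)// => [|j _]; last first.
  by rewrite mul1r lee_fin prodr_ge0// => i _; rewrite indicE.
rewrite mul1r big1 => [|i _]; last first.
  by rewrite indicE !nth_ord mem_set//= in_itv/=; have := xk i; rewrite mxE.
rewrite leeDl// nneseries_ge0// => j _ _.
by rewrite mul1r lee_fin prodr_ge0// => i _; rewrite indicE.
Qed.
End CubeVolume.

(** * Occupied cubes of a Poisson process *)

Section GroupedEvents.
Context {R : realType} {dO : measure_display} {Omega : measurableType dO}
  (Pr : probability Omega R).

Lemma uniq_flatten_map (S T : eqType) (F : S -> seq T) (s : seq S) :
  uniq s -> (forall i, uniq (F i)) ->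
  (forall i j x, x \in F i -> x \in F j -> i = j) -> uniq (flatten (map F s)).
Proof.
move=> + uF dF; elim: s => [//|i s IH] /= /andP[iNs us].
rewrite cat_uniq uF IH// andbT /=; apply/hasPn => x /flatten_mapP[j js xj].
by apply: contra iNs => xi; rewrite (dF _ _ _ xi xj).
Qed.

Lemma independent_events_grouped (S T : choiceType) (Ev : T -> set Omega) (pr : T -> R)
    (F : S -> seq T) :
  independent_events Pr Ev pr -> (forall i, uniq (F i)) ->
  (forall i j x, x \in F i -> x \in F j -> i = j) ->
  independent_events Pr (fun i => all_occur Ev (F i)) (fun i => \prod_(x <- F i) pr x).
Proof.
move=> [mEv indEv] uF dF; split=> [i|s us]; first exact: measurable_all_occur.
have -> : all_occur (fun i => all_occur Ev (F i)) s = all_occur Ev (flatten (map F s)).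
  apply/seteqP; split => w Hw.
    by move=> x /flatten_mapP[i si xi]; exact: Hw xi.
  by move=> i si x xi; apply: Hw; apply/flatten_mapP; exists i.
by rewrite indEv ?uniq_flatten_map// big_flatten big_map.
Qed.

Definition sum_fam (S T : Type) (A : Type) (f : S -> A) (g : T -> A) (x : S + T) : A :=
  match x with inl i => f i | inr j => g j end.

Lemma independent_events_sum (S T : choiceType) (Ev1 : S -> set Omega) (Ev2 : T -> set Omega)
    pr1 pr2 :
  independent_events Pr Ev1 pr1 -> independent_events Pr Ev2 pr2 ->
  (forall s t, Pr (all_occur Ev1 s `&` all_occur Ev2 t) =
               (Pr (all_occur Ev1 s) * Pr (all_occur Ev2 t))%E) ->
  independent_events Pr (sum_fam Ev1 Ev2) (sum_fam pr1 pr2).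
Proof.
move=> [mEv1 ind1] [mEv2 ind2] indep; split=> [[]//|s us].
pose s1 : seq S := pmap (sum_fam Some (fun=> None)) s.
pose s2 : seq T := pmap (sum_fam (fun=> None) Some) s.
have us1 : uniq s1 by apply: (@pmap_uniq _ _ _ inl) => // -[].
have us2 : uniq s2 by apply: (@pmap_uniq _ _ _ inr) => // -[].
have -> : all_occur (sum_fam Ev1 Ev2) s = all_occur Ev1 s1 `&` all_occur Ev2 s2.
  rewrite /s1 /s2; elim: s {us s1 s2 us1 us2} => [|[i|j] s IH].
  - by apply/seteqP; split => w // _; split.
  - by rewrite [pmap]lock /= -lock/= !all_occur_cons IH setIA.
  - by rewrite [pmap]lock /= -lock/= !all_occur_cons IH setICA.
rewrite indep ind1// ind2// -EFinM; congr (_%:E).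
rewrite /s1 /s2; elim: s {us s1 s2 us1 us2} => [|[i|j] s IH]; rewrite /= ?big_nil ?mulr1//.
  by rewrite !big_cons -IH mulrA.
by rewrite !big_cons -IH mulrCA.
Qed.

End GroupedEvents.

Section PoissonCubes.
Context {R : realType} {d : nat} {dO : measure_display} {Omega : measurableType dO}
  (Pr : probability Omega R).
Implicit Types (N : Omega -> set 'rV[R]_d) (z : {ffun 'I_d -> int}).

Definition occupied N (a : R) z : set Omega := [set w | exists2 x, N w x & cube a z x].

Lemma rV_norm_le (x : 'rV[R]_d) (M : R) : 0 <= M -> (forall i, `|x ord0 i| <= M) -> `|x| <= M.
Proof.
move=> M0 xM; rewrite [`|x|]mx_normrE; apply: bigmax_le => // -[i j] _ /=.
by rewrite ord1.
Qed.

Lemma rV_coord_le (x : 'rV[R]_d) i : `|x ord0 i| <= `|x|.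
Proof.
rewrite [leRHS]mx_normrE.
exact: (@le_bigmax _ _ _ 0 (fun ij : 'I_1 * 'I_d => `|x ij.1 ij.2|) (ord0, i)).
Qed.

Lemma bounded_setP (A : set 'rV[R]_d) (M : R) :
  (forall x, A x -> forall i, `|x ord0 i| <= M) -> bounded_set A.
Proof.
move=> AM; exists (Num.max M 0); split; first exact: num_real.
move=> M'; rewrite gt_max => /andP[MM' M'0] x Ax.
apply: rV_norm_le => [|i]; first exact: ltW.
by rewrite (le_trans (AM _ Ax i))// ltW.
Qed.

Lemma bounded_borel_cube (a : R) z : bounded_borel (cube a z).
Proof.
split; last first.
  apply: (@bounded_setP _ (\sum_i (`|a * (z i)%:~R| + `|a|))) => x xz i.
  rewrite (bigD1 i)//= -[leLHS]addr0; apply: lerD.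
    have /andP[] := xz i; rewrite ler_norml.
    have /ler_normlP[] := lexx `|a * (z i)%:~R|; have /ler_normlP[] := lexx `|a|; lra.
  by apply: sumr_ge0 => j _; rewrite addr_ge0.
have -> : cube a z = \bigcap_(i in setT)
   ((fun x : 'rV[R]_d => x ord0 i) @^-1` [set t | a * (z i)%:~R <= t < a * (z i)%:~R + a]).
  by apply/seteqP; split => x /= xz i => [_|]; exact: xz.
apply: (@fin_bigcap_measurable _ (g_sigma_algebraType (@open 'rV[R]_d))) => // i _.
have op (D : set R) : open D ->
    measurable ((fun x : 'rV[R]_d => x ord0 i) @^-1` D :
      set (g_sigma_algebraType (@open 'rV[R]_d))).
  move=> oD; apply: sub_sigma_algebra; apply: open_comp => // x _.
  exact: coord_continuous.
rewrite (_ : _ @^-1` _ = (fun x : 'rV[R]_d => x ord0 i) @^-1` [set t | t < a * (z i)%:~R + a] `\`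
   (fun x : 'rV[R]_d => x ord0 i) @^-1` [set t | t < a * (z i)%:~R]).
  by apply: measurableD; apply: op; exact: open_lt.
apply/seteqP; split => x /=; first by move=> /andP[h1 h2]; split => //; apply/negP; rewrite -leNgt.
by move=> [-> /negP]; rewrite -leNgt => ->.
Qed.

Lemma cube_inj (a : R) z z' x : 0 < a -> cube a z x -> cube a z' x -> z = z'.
Proof.
move=> a0 xz xz'; apply/ffunP => i.
have /andP[h1 h2] := xz i; have /andP[h3 h4] := xz' i.
have lt_int (m n : int) : a * m%:~R < a * n%:~R + a -> m <= n.
  have -> : a * n%:~R + a = a * (n + 1)%:~R by rewrite intrD mulrDr mulr1.
  by rewrite ltr_pM2l// ltr_int ltzD1.
by apply/eqP; rewrite eq_le !lt_int//; lra.
Qed.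

Lemma trivIset_cube (a : R) (s : seq {ffun 'I_d -> int}) : 0 < a -> uniq s ->
  trivIset setT (fun i : 'I_(size s) => cube a (tnth (in_tuple s) i)).
Proof.
move=> a0 us i j _ _ [x [xi xj]].
have /eqP := cube_inj a0 xi xj.
rewrite !(tnth_nth [ffun=> 0]) /= nth_uniq// => /eqP.
exact: val_inj.
Qed.

Lemma setC_occupied N a z : ~` occupied N a z = count_event N (cube a z) 0.
Proof.
apply/seteqP; split => w.
  move=> nocc; rewrite /count_event /= II0 card_eq0; apply/eqP.
  by apply/seteqP; split => // x [Nx zx]; apply: nocc; exists x.
rewrite /count_event /= II0 card_eq0 => /eqP empt [x Nx zx].
by have : (N w `&` cube a z) x by []; rewrite empt.
Qed.

Lemma poisson_prob0 (rate : R) : 0 <= rate -> poisson_prob rate 0 [set 0%N] = (expR (- rate))%:E.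
Proof.
rewrite /poisson_prob le_eqVlt => /orP[/eqP <-|rate0].
  by rewrite ltxx oppr0 expR0 /= diracE mem_set.
rewrite rate0 esum_set1 ?lee_fin ?poisson_pmf_ge0// /poisson_pmf rate0.
by rewrite expr0 fact0 invr1 !mul1r.
Qed.

(** A cube is vacant when its count is 0; disjoint cubes have independent counts, and each is vacant
    with the Poisson probability [expR (- (lam * a ^+ d))]. Complements give occupation. *)
Lemma independent_occupied N (lam a : R) : (0 < d)%N -> 0 < lam -> 0 < a ->
  poisson_process Pr lam N ->
  independent_events Pr (occupied N a) (fun=> 1 - expR (- (lam * a ^+ d))).
Proof.
move=> d0 lam0 a0 poisN.
suff : independent_events Pr (fun z => ~` occupied N a z) (fun=> expR (- (lam * a ^+ d))).
  by move=> /independent_events_setC; under eq_fun do rewrite setCK.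
split=> [z|s us].
  rewrite setC_occupied; apply: (pp_measurable poisN); exact: bounded_borel_cube.
have -> : all_occur (fun z => ~` occupied N a z) s =
    \bigcap_(i : 'I_(size s)) count_event N (cube a (tnth (in_tuple s) i)) 0.
  apply/seteqP; split => w Hw.
    by move=> i _; rewrite -setC_occupied; apply: Hw; exact: mem_tnth.
  move=> z zs; rewrite setC_occupied.
  have /tnthP[i ->] : z \in in_tuple s by [].
  exact: Hw.
rewrite (pp_indep poisN (fun=> 0%N)); last exact: trivIset_cube.
  rewrite (big_tnth _ _ s) -prodEFin; apply: eq_bigr => i _.
  have bc := bounded_borel_cube a (tnth (in_tuple s) i).
  rewrite (pp_poisson poisN)// volume_cube//= poisson_prob0//.
  by rewrite mulr_ge0 ?exprn_ge0 ?ltW.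
by move=> i; exact: bounded_borel_cube.
Qed.

(** Makes the independence of two processes applicable to their occupation events. *)
Lemma process_sigma_algebra_all_occur N a s :
  process_sigma_algebra N (all_occur (occupied N a) s).
Proof.
have [salgT _ _ salgI] := (sigma_algebraP (fun _ _ => @subsetT _ _)).1
  (smallest_sigma_algebra setT
     [set count_event N A n | A in bounded_borel & n in [set: nat]]).
elim: s => [|z s IH].
  by rewrite (_ : all_occur _ _ = setT)//; apply/seteqP; split.
rewrite all_occur_cons; apply: salgI => //.
rewrite -[occupied _ _ _]setCK setC_occupied -setTD; apply: sigma_algebraCD.
apply: sub_sigma_algebra; exists (cube a z); first exact: bounded_borel_cube.
by exists 0%N.
Qed.

End PoissonCubes.

(** * Lattice paths *)

Section LatticeBox.
Context {d : nat}.
Implicit Types (z lo : {ffun 'I_d -> int}).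

Definition int_box lo (n : nat) : seq {ffun 'I_d -> int} :=
  [seq [ffun i => lo i + (k i : nat)%:Z] | k : {ffun 'I_d -> 'I_n} <- enum {ffun 'I_d -> 'I_n}].

Lemma mem_int_box lo n z :
  reflect (forall i, lo i <= z i < lo i + n%:Z) (z \in int_box lo n).
Proof.
apply: (iffP mapP) => [[k _ ->] i|zlo].
  by rewrite ffunE lerDl ltrD2l ltz_nat ltn_ord.
have lt_n i : (`|z i - lo i| < n)%N by have := zlo i; lia.
exists [ffun i => Ordinal (lt_n i)]; first by rewrite mem_enum.
by apply/ffunP => i; rewrite !ffunE /=; have := zlo i; lia.
Qed.

Lemma int_box_uniq lo n : uniq (int_box lo n).
Proof.
rewrite map_inj_uniq ?enum_uniq// => k k' /ffunP kk'.
by apply/ffunP => i; apply: val_inj; have := kk' i; rewrite !ffunE => /addrI[].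
Qed.

Lemma size_int_box lo n : size (int_box lo n) = (n ^ d)%N.
Proof. by rewrite size_map -cardE card_ffun !card_ord. Qed.

Definition centered_box (M : nat) := int_box [ffun=> - M%:Z] (2 * M + 1).

Lemma mem_centered_box M z : reflect (forall i, `|z i| <= M%:Z) (z \in centered_box M).
Proof.
apply: (iffP (mem_int_box _ _ _)) => zM i; have := zM i; rewrite ffunE; lia.
Qed.

End LatticeBox.

Section LatticePaths.
Context {d : nat}.
Local Notation site := {ffun 'I_d -> int}.
Context (E : rel site) (L : nat).
Hypothesis E_le : forall z z', E z z' -> forall i, `|z i - z' i| <= L%:Z.
Implicit Types (z x : site) (p : seq site) (A : set site) (U V : seq site).

Definition path_in A x p := [/\ path E x p, uniq (x :: p) & forall z, z \in x :: p -> A z].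

(** Self-avoiding paths of every length from a bounded box stand in for an infinite component; at a
    given length only finitely many sites are involved. *)
Definition far_path A (M N : nat) :=
  exists x p, [/\ x \in centered_box M, path_in A x p & size p = N].

Lemma path_le x p z : path E x p -> z \in x :: p ->
  forall i, `|x i - z i| <= (L * size p)%:Z.
Proof.
elim: p x => [|y p IH] x /=; first by rewrite inE => _ /eqP-> i; rewrite subrr.
move=> /andP[/E_le xy yp]; rewrite inE => /orP[/eqP->|zp] i.
  by rewrite subrr normr0.
by have := xy i; have := IH _ yp zp i; rewrite /=; lia.
Qed.

Lemma far_path_in_box A M N x p z :
  x \in centered_box M -> path_in A x p -> size p = N -> z \in x :: p ->
  z \in centered_box (M + L * N).
Proof.
move=> /mem_centered_box xM [xp _ _] <- zp; apply/mem_centered_box => i.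
by have := xM i; have := path_le xp zp i; lia.
Qed.

Lemma path_in_take A x p n : path_in A x p -> path_in A x (take n p).
Proof.
move=> [xp up Ap]; split.
- by move: xp; rewrite -{1}(cat_take_drop n p) cat_path => /andP[].
- exact: (@take_uniq _ (x :: p) n.+1).
- by move=> z; rewrite inE => /orP[/eqP->|/mem_take zp]; apply: Ap; rewrite inE ?eqxx ?zp ?orbT.
Qed.

Lemma far_path_decr A M N N' : (N' <= N)%N -> far_path A M N -> far_path A M N'.
Proof.
move=> NN' [x [p [xM xp sp]]]; exists x, (take N' p); split => //.
  exact: path_in_take.
by rewrite size_takel// sp.
Qed.

Lemma far_path_incr A M M' N : (M <= M')%N -> far_path A M N -> far_path A M' N.
Proof.
move=> MM' [x [p [/mem_centered_box xM xp sp]]]; exists x, p; split => //.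
by apply/mem_centered_box => i; have := xM i; lia.
Qed.

Lemma far_path_sub A B M N : (forall z, z \in centered_box (M + L * N) -> A z -> B z) ->
  far_path A M N -> far_path B M N.
Proof.
move=> AB [x [p [xM xp sp]]]; exists x, p; split => //.
have [h1 h2 h3] := xp; split => // z zp; apply: AB (h3 _ zp).
exact: far_path_in_box xM xp sp zp.
Qed.

Definition reachable A x := [set y | exists2 p, path E x p /\ (forall z, z \in x :: p -> A z)
                                               & last x p = y].

(** Loops can be cut out of any path. If no self-avoiding path had length [N], all reachable sites
    would lie within [L * N] of the starting box, which is finite. *)
Lemma reachable_far_path A x : infinite_set (reachable A x) ->
  exists M, forall N, far_path A M N.
Proof.
move=> infA; have [M xM] : exists M, x \in centered_box M.
  exists (\max_i `|x i|)%N; apply/mem_centered_box => i.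
  by have := @leq_bigmax _ (fun i => `|x i|%N) i; lia.
exists M => N; apply: contrapT => noP; apply: infA.
apply: (@sub_finite_set _ _ [set` centered_box (M + L * N)]); last exact: finite_seq.
move=> _ [p [xp Ap] <-] /=.
case: (shortenP xp) Ap => p' xp' up' p'p Ap.
have Ap' z : z \in x :: p' -> A z.
  by rewrite inE => /orP[/eqP->|/p'p zp]; apply: Ap; rewrite inE ?eqxx// zp orbT.
have sp' : (size p' < N)%N.
  rewrite ltnNge; apply/negP => Np'; apply: noP.
  by exists x, (take N p'); split; [|exact: path_in_take|rewrite size_takel].
have /mem_centered_box h : last x p' \in centered_box (M + L * size p').
  exact: (@far_path_in_box A _ _ x p' _ xM _ _ (mem_last _ _)).
apply/mem_centered_box => i; apply: le_trans (h i) _.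
by rewrite lez_nat leq_add2l leq_mul2l ltnW ?orbT.
Qed.

(** If each site failed at some length, a path at least as long as all failing lengths in the finite
    box would, once truncated, contradict the failure of its own starting site. A site with
    self-avoiding paths of every length reaches infinitely many sites. *)
Lemma far_path_reachable A M : (forall N, far_path A M N) ->
  exists2 x, A x & infinite_set (reachable A x).
Proof.
move=> farA.
have [x xA] : exists x, forall N, exists2 p, path_in A x p & size p = N.
  apply: contrapT => /forallNP noX.
  have bad x : exists N, ~ exists2 p, path_in A x p & size p = N.
    by have /existsNP := noX x.
  have [/= Nx badN] := choice bad.
  have [x [p [xM xp sp]]] := farA (\max_(z <- centered_box M) Nx z)%N.
  apply: (badN x); exists (take (Nx x) p); first exact: path_in_take.
  by rewrite size_takel// sp; apply: leq_bigmax_seq.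
exists x; first by have [p [_ _ Ap] _] := xA 0%N; apply: Ap; exact: mem_head.
move=> /finite_seqP[s sE].
have [p [xp up Ap] sp] := xA (size s).
have : (size (x :: p) <= size s)%N.
  apply: uniq_leq_size => // z zp.
  suff : reachable A x z by rewrite sE.
  have [p1 [p2 [pE zE]]] : exists p1 p2, p = p1 ++ p2 /\ last x p1 = z.
    by case/splitPl : zp => p1 p2 lz; exists p1, p2.
  exists p1 => //; split; first by move: xp; rewrite pE cat_path => /andP[].
  by move=> y; rewrite inE => /orP[/eqP->|yp]; apply: Ap; rewrite pE inE ?eqxx// mem_cat yp orbT.
by rewrite /= sp ltnn.
Qed.

End LatticePaths.

(** * Comparison of percolation on the lattice *)

Lemma ae_probability1 {R : realType} {dO : measure_display} {Omega : measurableType dO}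
    (Pr : probability Omega R) (A : set Omega) : measurable A ->
  {ae Pr, forall w, A w} <-> Pr A = 1%E.
Proof.
move=> mA; have mCA : measurable (~` A) by exact: measurableC.
have -> : {ae Pr, forall w, A w} = Pr.-negligible (~` A) by [].
have nP : Pr.-negligible (~` A) <-> Pr (~` A) = 0%E by exact: negligibleP.
rewrite nP probability_setC//.
rewrite -(fineK (fin_num_measure Pr A mA)) -EFinB; split=> [[]|[->]]; last by rewrite subrr.
by move/eqP; rewrite subr_eq0 => /eqP <-.
Qed.

Section PercolationTransfer.
Context {R : realType} {dO : measure_display} {Omega : measurableType dO}
  (Pr : probability Omega R) {d : nat}.
Local Notation site := {ffun 'I_d -> int}.
Context (E : rel site) (L : nat).
Hypothesis L_gt0 : (0 < L)%N.
Hypothesis E_le : forall z z', E z z' -> forall i, `|z i - z' i| <= L%:Z.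
Implicit Types (z b : site) (w : Omega) (M N : nat).

Definition block z : site := [ffun i => (z i %/ L)%Z].

Definition block_sites b := int_box [ffun i => L%:Z * b i] L.

Lemma mem_block_sites b z : (z \in block_sites b) = (block z == b).
Proof.
apply/mem_int_box/eqP => [zb|<- i].
  apply/ffunP => i; rewrite ffunE; have := zb i; rewrite ffunE => /andP[h1 h2].
  have -> : z i = b i * L%:Z + (z i - L%:Z * b i) by rewrite mulrC addrC subrK.
  by rewrite divzMDl ?divz_small ?addr0//; lia.
rewrite !ffunE; have := divz_eq (z i) L.
by have := @modz_ge0 (z i) L; have := @ltz_mod (z i) L; lia.
Qed.

Definition far_path_event (A : site -> set Omega) M N : set Omega :=
  [set w | far_path E (fun z => A z w) M N].

Definition seq_far_path M N (U : seq site) : bool := `[< far_path E [set` U] M N >].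

Definition window M N := centered_box (d := d) (M + L * N).

Lemma block_window M N z : z \in window M N -> block z \in window M N.
Proof.
move=> /mem_centered_box zM; apply/mem_centered_box => i; rewrite ffunE.
by have := zM i; have := divz_eq (z i) L; have := @modz_ge0 (z i) L; have := @ltz_mod (z i) L; nia.
Qed.

Lemma mem_window_sites M N z : z \in window M N ->
  z \in flatten (map block_sites (window M N)).
Proof.
move=> zM; apply/flatten_mapP; exists (block z); first exact: block_window.
by rewrite mem_block_sites.
Qed.

(** The sites are listed in whole blocks that cover the window, since [subset_mean_blocks] compares
    the two models on such a list. *)
Lemma far_path_occurring (A : site -> set Omega) M N :
  far_path_event A M N =
  [set w | seq_far_path M N (occurring A (flatten (map block_sites (window M N))) w)].
Proof.
apply/seteqP; split => w /=.
  move=> farA; apply/asboolP; apply: (far_path_sub E_le) farA => z zM Az /=.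
  by rewrite mem_filter mem_window_sites// andbT; apply/asboolP.
by move=> /asboolP; apply: (far_path_sub E_le) => z zM /=; rewrite mem_filter => /andP[/asboolP].
Qed.

Lemma far_path_surviving (A B : site -> set Omega) M N :
  far_path_event (fun z => A z `&` B (block z)) M N =
  [set w | seq_far_path M N (surviving block
     (occurring (sum_fam A B) (with_blocks block_sites (window M N)) w))].
Proof.
apply/seteqP; split => w /=.
  move=> farA; apply/asboolP; apply: (far_path_sub E_le) farA => z zM [Az Bz] /=.
  rewrite mem_surviving !mem_filter /=.
  apply/andP; split; (apply/andP; split; first exact/asboolP); apply/flatten_mapP;
    exists (block z); rewrite ?block_window// inE ?eqxx//=.
  by rewrite map_f// mem_block_sites.
move=> /asboolP; apply: (far_path_sub E_le) => z zM /=.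
by rewrite mem_surviving !mem_filter /= => /andP[/andP[/asboolP ? _] /andP[/asboolP ? _]].
Qed.

Lemma increasing_seq_far_path M N : @increasing R site (fun U => (seq_far_path M N U)%:R).
Proof.
move=> U V UV; rewrite ler_nat /seq_far_path.
case: asboolP => // farU; rewrite lt0b; apply/asboolP.
by apply: (far_path_sub E_le) farU => z _; exact: UV.
Qed.

Lemma block_sites_uniq M N : uniq (flatten (map block_sites (window M N))).
Proof.
apply: uniq_flatten_map => [|b|b b' z]; [exact: int_box_uniq..|].
by rewrite !mem_block_sites => /eqP <- /eqP.
Qed.

Lemma with_blocks_uniq M N : uniq (with_blocks block_sites (window M N)).
Proof.
apply: uniq_flatten_map => [|b|b b' x]; first exact: int_box_uniq.
  rewrite /= map_inj_uniq ?int_box_uniq ?andbT; last by move=> ? ? [].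
  by apply/mapP => -[].
rewrite !inE; case: x => [z|c] /=.
  move=> /mapP[y yb [->]] /mapP[y' y'b [yy']]; move: yb y'b.
  by rewrite -yy' !mem_block_sites => /eqP <- /eqP.
have noc (s : seq site) : inr c \in map inl s = false by apply/mapP => -[].
by rewrite !noc !orbF => /eqP[->] /eqP[].
Qed.

Definition percolates (A : set site) := exists M, forall N, far_path E A M N.

Lemma percolates_bigcup (A : site -> set Omega) :
  [set w | percolates (fun z => A z w)] = \bigcup_M \bigcap_N far_path_event A M N.
Proof.
apply/seteqP; split => w; first by move=> [M farA]; exists M => // N _; exact: farA.
by move=> [M _ farA]; exists M => N; exact: farA.
Qed.

(** Far-path events decrease with the length [N] and increase with the radius [M]: continuity of the
    measure from above, then from below, carries the comparison to the limit. *)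
Lemma le_percolation (A B : site -> set Omega) :
  (forall M N, measurable (far_path_event A M N)) ->
  (forall M N, measurable (far_path_event B M N)) ->
  (forall M N, Pr (far_path_event A M N) <= Pr (far_path_event B M N))%E ->
  (Pr [set w | percolates (fun z => A z w)] <= Pr [set w | percolates (fun z => B z w)])%E.
Proof.
move=> mA mB leAB; rewrite !percolates_bigcup.
have mcap C M : (forall M N, measurable (far_path_event C M N)) ->
  measurable (\bigcap_N far_path_event C M N).
  by move=> mC; exact: bigcapT_measurable.
have leM M : (Pr (\bigcap_N far_path_event A M N) <= Pr (\bigcap_N far_path_event B M N))%E.
  have /cvg_lim <- // : Pr (far_path_event B M N) @[N --> \oo] -->
      Pr (\bigcap_N far_path_event B M N).
    apply: nonincreasing_cvg_mu => //; first by rewrite ltey_eq fin_num_measure.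
      exact: mcap.
    by move=> m n mn; apply/subsetPset => w; exact: far_path_decr.
  apply: lime_ge.
    apply: ereal_nonincreasing_is_cvgn => m n mn.
    by apply: le_measure; rewrite ?inE// => w; exact: far_path_decr.
  apply: nearW => N; apply: le_trans (leAB M N).
  by apply: le_measure; rewrite ?inE//; [exact: mcap|exact: bigcap_inf].
have /cvg_lim <- // : Pr (\bigcap_N far_path_event A M N) @[M --> \oo] -->
    Pr (\bigcup_M \bigcap_N far_path_event A M N).
  apply: nondecreasing_cvg_mu => [M||m n mn]; first exact: mcap.
    by apply: bigcupT_measurable => M; exact: mcap.
  by apply/subsetPset => w farw N _; exact: far_path_incr mn (farw N I).
apply: lime_le.
  apply: ereal_nondecreasing_is_cvgn => m n mn.
  apply: le_measure; rewrite ?inE; [exact: mcap..|] => w farw N _.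
  exact: far_path_incr mn (farw N I).
apply: nearW => M; apply: le_trans (leM M) _.
apply: le_measure; rewrite ?inE; [exact: mcap| |by move=> w farw; exists M].
by apply: bigcupT_measurable => K; exact: mcap.
Qed.

(** At fixed [M] and [N] both probabilities are subset means of one increasing function, so
    [subset_mean_blocks] orders them; in the limit the larger one inherits the value 1. *)
Theorem percolation_transfer (A' A B : site -> set Omega) (p p' : R)
    (g : site -> R) :
  independent_events Pr A' (fun=> p') ->
  independent_events Pr (sum_fam A B) (sum_fam (fun=> p) g) ->
  0 <= p' -> p' < p -> p <= 1 -> (forall b, 0 <= g b <= 1) ->
  (forall b, 1 - g b <= (1 - p') ^+ (L ^ d) * (1 - p' / p)) ->
  {ae Pr, forall w, percolates (fun z => A' z w)} ->
  {ae Pr, forall w, percolates (fun z => A z w /\ B (block z) w)}.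
Proof.
move=> indA' indAB p'0 p'p p1 g01 gp aeA'.
have mA' M N : measurable (far_path_event A' M N).
  by rewrite far_path_occurring; exact/measurable_occurring/indA'.1.
pose C z := A z `&` B (block z).
have mC M N : measurable (far_path_event C M N).
  rewrite far_path_surviving.
  exact: (measurable_occurring _ (seq_far_path M N \o surviving block) indAB.1).
have mperc D : (forall M N, measurable (far_path_event D M N)) ->
    measurable [set w | percolates (fun z => D z w)].
  move=> mD; rewrite percolates_bigcup; apply: bigcupT_measurable => M.
  exact: bigcapT_measurable.
have : (Pr [set w | percolates (fun z => A' z w)] <= Pr [set w | percolates (fun z => C z w)])%E.
  apply: le_percolation => // M N; rewrite far_path_occurring far_path_surviving.
  rewrite (probability_occurring _ indA' (block_sites_uniq M N)).
  rewrite (probability_occurring (seq_far_path M N \o surviving block) indAB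
    (with_blocks_uniq M N)).
  rewrite lee_fin.
  have := @subset_mean_blocks R _ _ block p p' g block_sites (window M N) _
    p'0 p'p p1 g01 _ _ (increasing_seq_far_path M N).
  apply=> [b z|b]; first by rewrite mem_block_sites => /eqP.
  by rewrite size_int_box.
have /(ae_probability1 Pr (mperc _ mA')) -> := aeA'.
move=> PC1; apply/(ae_probability1 Pr (mperc _ mC)); apply/eqP.
by rewrite eq_le PC1 probability_le1//; exact: mperc.
Qed.

End PercolationTransfer.

(** * Discretization of the geometric graphs *)

Section EuclideanNorm.
Context {R : realType} {d : nat}.
Implicit Types (x y : 'rV[R]_d).

Lemma enorm_ge0 x : 0 <= enorm x.
Proof. exact: sqrtr_ge0. Qed.

Lemma sqr_enorm x : enorm x ^+ 2 = \sum_(i < d) x ord0 i ^+ 2.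
Proof. by rewrite sqr_sqrtr// sumr_ge0// => i _; exact: sqr_ge0. Qed.

Lemma enorm_coord x i : `|x ord0 i| <= enorm x.
Proof.
rewrite -ler_sqr ?nnegrE ?enorm_ge0// sqr_enorm (bigD1 i)//= real_normK ?num_real//.
by rewrite lerDl sumr_ge0// => j _; exact: sqr_ge0.
Qed.

Lemma enormN x : enorm (- x) = enorm x.
Proof. by congr Num.sqrt; apply: eq_bigr => i _; rewrite mxE sqrrN. Qed.

Lemma enormZ (c : R) x : 0 <= c -> enorm (c *: x) = c * enorm x.
Proof.
move=> c0; apply/eqP; rewrite -(eqrXn2 (ltn0Sn 1)) ?mulr_ge0 ?enorm_ge0//.
by rewrite exprMn !sqr_enorm mulr_sumr; apply/eqP/eq_bigr => i _; rewrite mxE exprMn.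
Qed.

Lemma enormD x y : enorm (x + y) <= enorm x + enorm y.
Proof.
have [x0|xn0] := eqVneq (enorm x) 0.
  have -> : x = 0.
    apply/rowP => i; apply/eqP; rewrite mxE -normr_le0 -x0.
    exact: enorm_coord.
  by rewrite add0r lerDr enorm_ge0.
have [y0|yn0] := eqVneq (enorm y) 0.
  have -> : y = 0.
    apply/rowP => i; apply/eqP; rewrite mxE -normr_le0 -y0.
    exact: enorm_coord.
  by rewrite addr0 lerDl enorm_ge0.
have xp : 0 < enorm x by rewrite lt_neqAle eq_sym xn0 enorm_ge0.
have yp : 0 < enorm y by rewrite lt_neqAle eq_sym yn0 enorm_ge0.
rewrite -ler_sqr ?nnegrE ?addr_ge0 ?enorm_ge0//.
have -> : enorm (x + y) ^+ 2 = enorm x ^+ 2 + enorm y ^+ 2 + \sum_i 2 * (x ord0 i * y ord0 i).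
  by rewrite !sqr_enorm -!big_split; apply: eq_bigr => i _ /=; rewrite mxE; ring.
rewrite sqrrD [leRHS]addrAC lerD2l.
(* AM-GM with the weights that make it an equality after summation *)
have -> : enorm x * enorm y *+ 2 =
    \sum_i (enorm y / enorm x * x ord0 i ^+ 2 + enorm x / enorm y * y ord0 i ^+ 2).
  by rewrite big_split -!mulr_sumr -!sqr_enorm /=; field; rewrite xn0 yn0.
apply: ler_sum => i _; rewrite -subr_ge0.
rewrite [leRHS](_ : _ = (enorm x * enorm y)^-1 *
    (enorm y * x ord0 i - enorm x * y ord0 i) ^+ 2).
  by rewrite mulr_ge0 ?sqr_ge0// invr_ge0 mulr_ge0 ?ltW.
by field; rewrite xn0 yn0.
Qed.

Lemma enorm_le x (c : R) : 0 <= c -> (forall i, `|x ord0 i| <= c) ->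
  enorm x <= d%:R * c.
Proof.
move=> c0 xc; rewrite -ler_sqr ?nnegrE ?mulr_ge0 ?enorm_ge0// sqr_enorm.
apply: (@le_trans _ _ (\sum_(i < d) c ^+ 2)).
  by apply: ler_sum => i _; rewrite -[leLHS]real_normK ?num_real// ler_sqr ?nnegrE.
rewrite sumr_const card_ord exprMn -[leLHS]mulr_natl; apply: ler_wpM2r; first exact: sqr_ge0.
by rewrite -natrX ler_nat; case: (d) => // n; rewrite expnS expn1 leq_pmulr.
Qed.

End EuclideanNorm.

Section Discretization.
Context {R : realType} {d : nat}.
Local Notation site := {ffun 'I_d -> int}.
Implicit Types (z : site) (a r rho : R) (X Y : set 'rV[R]_d).

Definition occupied_sites X a : set site := [set z | exists2 x, X x & cube a z x].

(** The two points range over the whole cubes and not over the process: the lattice graph is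
    deterministic, and randomness remains only in the occupation of the sites. *)
Definition close_cubes a rho : rel site := fun z z' =>
  `[< exists u v, [/\ cube a z u, cube a z' v & enorm (u - v) <= rho] >].

Lemma close_cubes_le a rho (L : nat) : 0 < a -> rho / a + 1 <= L%:R ->
  forall z z', close_cubes a rho z z' -> forall i, `|z i - z' i| <= L%:Z.
Proof.
move=> a0 aL z z' /asboolP[u [v [zu zv uv]]] i.
have := le_trans (enorm_coord (u - v) i) uv; rewrite !mxE ler_norml => /andP[h1 h2].
have /andP[h3 h4] := zu i; have /andP[h5 h6] := zv i.
have aL' : rho + a <= a * L%:R.
  by rewrite -ler_pdivrMl// mulrDr mulVf ?gt_eqF// [_^-1 * _]mulrC.
rewrite ler_norml; apply/andP; split.
  rewrite -(ler_int R) -(ler_pM2l a0) intrB rmorphN/= mulrBr mulrN; lra.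
by rewrite -(ler_int R) -(ler_pM2l a0) intrB mulrBr; lra.
Qed.

Definition cube_of a (x : 'rV[R]_d) : site := [ffun i => Num.floor (x ord0 i / a)].

Lemma cube_cube_of a x : 0 < a -> cube a (cube_of a x) x.
Proof.
move=> a0 i; rewrite ffunE; have /andP[h1 h2] := floor_itv (x ord0 i / a).
have xE : x ord0 i = a * (x ord0 i / a) by rewrite mulrCA divff ?mulr1// gt_eqF.
rewrite {2 3}xE ler_pM2l// h1 /= -[X in _ < _ + X]mulr1 -mulrDr ltr_pM2l//.
by move: h2; rewrite intrD.
Qed.

Lemma component_trans (T : Type) (G : graph T) (x y z : T) :
  component G x y -> component G y z -> component G x z.
Proof.
move=> [p xp <-] [q yq <-]; exists (p ++ q); last by rewrite last_cat.
by rewrite cat_path xp.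
Qed.

Lemma component_adj (T : Type) (G : graph T) (x y : T) : Defs.adjacent G x y -> component G x y.
Proof. by move=> xy; exists [:: y] => //=; rewrite andbT; apply/asboolP. Qed.

Lemma bounded_cube a z : bounded_set (cube a z).
Proof. by have [] := bounded_borel_cube a z. Qed.

(** A component projects to a connected set of occupied cubes. Each cube holds finitely many points,
    so an infinite component meets infinitely many cubes. *)
Lemma geometric_percolates X a rho : 0 < a -> 0 <= rho -> locally_finite X ->
  has_infinite_component (geometric_graph X rho) ->
  percolates (close_cubes a rho) (occupied_sites X a).
Proof.
move=> a0 rho0 lfX [x /= Xx infx].
have [L aL] : exists L : nat, rho / a + 1 <= L%:R.
  exists (Num.truncn (rho / a + 1)).+1; exact/ltW/truncnS_gt.
apply: (@reachable_far_path _ _ L (close_cubes_le a0 aL) _ (cube_of a x)) => fin.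
apply: infx.
pose C := component (geometric_graph X rho) x.
have CX y : C y -> X y.
  move=> [p xp <-]; elim: p x Xx xp {fin C} => [//|y' p IH] x Xx /= /andP[/asboolP[_ Xy _ _]].
  exact: IH.
have Csub : C `<=` \bigcup_(z in reachable (close_cubes a rho) (occupied_sites X a) (cube_of a x))
    (X `&` cube a z).
  move=> y Cy; exists (cube_of a y); last by split; [exact: CX|exact: cube_cube_of].
  have [p xp <-] := Cy; exists (map (cube_of a) p); last by rewrite last_map.
  split.
    elim: p x xp {Xx C CX Cy fin} => [//|y' p IH] x /= /andP[/asboolP[_ _ _ xy'] yp].
    rewrite IH// andbT; apply/asboolP; exists x, y'.
    by split => //; exact: cube_cube_of.
  move=> z; rewrite -[_ :: _]/(map (cube_of a) (x :: p)) => /mapP[t tp ->].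
  exists t; last exact: cube_cube_of.
  apply: CX; case/splitPl : tp xp => p1 p2 <-; rewrite cat_path => /andP[xp1 _].
  by exists p1.
apply: sub_finite_set Csub _; apply: bigcup_finite => // z _.
by apply: lfX; exact: bounded_cube.
Qed.

End Discretization.

(** * From the bipartite graph to the geometric one, and back through reserved cells *)

Section BipartiteGeometry.
Context {R : realType} {d : nat}.
Local Notation site := {ffun 'I_d -> int}.
Implicit Types (z b : site) (a r eps : R) (X Y : set 'rV[R]_d).

Lemma bounded_enorm_ball (x : 'rV[R]_d) r : bounded_set [set y | enorm (x - y) <= r].
Proof.
apply: (@bounded_setP _ _ _ (`|x| + r)) => y /= xy i.
have := le_trans (enorm_coord (x - y) i) xy; have := rV_coord_le x i.
rewrite !mxE !ler_norml => /andP[h1 h2] /andP[h3 h4]; apply/andP; split; lra.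
Qed.

(** Two points of [X] with a common neighbour in [Y] are within [2 * r]. If they formed a finite
    component, only finitely many points of the locally finite [Y] would be adjacent to it. *)
Lemma geometric_of_bipartite X Y r : locally_finite Y ->
  has_infinite_component (bipartite_geometric_graph X Y r) ->
  has_infinite_component (geometric_graph X (2 * r)).
Proof.
move=> lfY [u Gu infu].
have [x Xx infx] : exists2 x, X x &
    infinite_set (component (bipartite_geometric_graph X Y r) (inl x)).
  case: u Gu infu => [x Xx infx|y Yy infy]; first by exists x.
  have [x yx] : exists x, Defs.adjacent (bipartite_geometric_graph X Y r) (inr y) (inl x).
    apply: contrapT => nox; apply: infy.
    apply: (@sub_finite_set _ _ [set inr y]); last exact: finite_set1.
    move=> v [[|v' p] /=]; first by move=> _ <-.
    move=> /andP[/asboolP yv' _] _; case: nox.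
    by case: v' yv' => [x' yx'|//]; exists x'.
  have xy : Defs.adjacent (bipartite_geometric_graph X Y r) (inl x) (inr y) by [].
  exists x; first by case: yx.
  apply: sub_infinite_set infy => v; apply: component_trans; exact: component_adj.
exists x => // fin; apply: infx.
pose C := component (geometric_graph X (2 * r)) x.
pose inv (v : 'rV[R]_d + 'rV[R]_d) := match v with
  | inl x' => C x' /\ X x'
  | inr y => exists2 x', C x' & [/\ X x', Y y & enorm (x' - y) <= r] end.
have invP v : component (bipartite_geometric_graph X Y r) (inl x) v -> inv v.
  move=> [p + <-]; have : inv (inl x) by split => //; exists [::].
  elim: p (inl x) => [//|v' p IH] u' /= invu /andP[/asboolP uv' v'p].
  apply: IH v'p; case: u' v' invu uv' => [x1|y1] [x2|y2] //=.
    by move=> [Cx1 _] [Xx1 Yy2 xy]; exists x1.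
  move=> [x1 Cx1 [Xx1 Yy1 x1y]] [Xx2 _ x2y]; split => //.
  (* A bipartite path may return at once to the same point, whereas the geometric graph has no
     loops. *)
  have [<-//|/eqP x12] := eqVneq x1 x2.
  apply: component_trans Cx1 _; apply: component_adj; split => //.
  rewrite (_ : x1 - x2 = (x1 - y1) - (x2 - y1)); last by rewrite opprB addrA subrK.
  apply: le_trans (enormD _ _) _; rewrite enormN; lra.
apply: (@sub_finite_set _ _ ((inl @` C) `|`
    (inr @` (\bigcup_(x' in C) (Y `&` [set y | enorm (x' - y) <= r]))))).
  move=> [x'|y] /invP /=; first by move=> [Cx' _]; left; exists x'.
  by move=> [x' Cx' [_ Yy xy]]; right; exists y => //; exists x'.
rewrite finite_setU; split; first exact: finite_image.
apply: finite_image; apply: bigcup_finite => // x' _.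
by apply: lfY; exact: bounded_enorm_ball.
Qed.

Section Cells.
Variable L : nat.
Hypothesis L_gt0 : (0 < L)%N.

(* A block [b] may only use the points of one subcube (out of [3 ^ d]) of each
   cube of the nearby blocks; the subcube depends on the position of [b]
   relative to the block of the cube, so that distinct blocks use distinct
   subcubes. *)
Definition owner (y : site) : site := [ffun i => ((y i %/ 3)%Z %/ L)%Z + (y i %% 3)%Z - 1].

(** The box spans, along each axis, the [3 * (3 * L)] subcubes of the blocks [b - 1], [b] and
    [b + 1]; a middle cell for a cube of [b] lies no further away. *)
Definition owned_cells b : seq site :=
  [seq y <- int_box [ffun i => 3 * L%:Z * (b i - 1)] (9 * L) | owner y == b].

Lemma owned_cells_inj b b' y : y \in owned_cells b -> y \in owned_cells b' -> b = b'.
Proof. by rewrite !mem_filter => /andP[/eqP <- _] /andP[/eqP <-]. Qed.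

Lemma owned_cells_uniq b : uniq (owned_cells b).
Proof. by rewrite filter_uniq// int_box_uniq. Qed.

Lemma size_owned_cells b : (size (owned_cells b) <= (9 * L) ^ d)%N.
Proof. by rewrite -(size_int_box [ffun i => 3 * L%:Z * (b i - 1)]) size_filter count_size. Qed.

Definition midpoint z z' : site := [ffun i => ((z i + z' i) %/ 2)%Z].

Lemma midpoint_le z z' i :
  midpoint z z' i * 2 <= z i + z' i <= midpoint z z' i * 2 + 1.
Proof.
rewrite ffunE; have := divz_eq (z i + z' i) 2; have := @modz_ge0 (z i + z' i) 2 isT.
have := @ltz_pmod (z i + z' i) 2 isT; lia.
Qed.

(** In base 3 along each axis: the quotient is the cube of the midpoint, the remainder is the
    relative position that makes [block L z] the owner. *)
Definition middle_cell z z' : site :=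
  [ffun i => 3 * midpoint z z' i + (block L z i - (midpoint z z' i %/ L)%Z + 1)].

(** The rounded midpoint is within [L] of [z], hence in the same block or an adjacent one along each
    axis, and the offset is a valid remainder modulo 3. *)
Lemma middle_cell_subcube z z' i : (forall j, `|z j - z' j| <= L%:Z) ->
  0 <= block L z i - (midpoint z z' i %/ L)%Z + 1 <= 2.
Proof.
move=> /(_ i) zz'; rewrite !ffunE.
have := divz_eq (z i + z' i) 2; have := @modz_ge0 (z i + z' i) 2 isT.
have := @ltz_pmod (z i + z' i) 2 isT.
move: ((z i + z' i) %/ 2)%Z ((z i + z' i) %% 2)%Z => m e e2 e0 mE.
have := divz_eq (z i) L; have := @modz_ge0 (z i) L; have := @ltz_pmod (z i) L.
move: (z i %/ L)%Z (z i %% L)%Z => q s.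
have := divz_eq m L; have := @modz_ge0 m L; have := @ltz_pmod m L.
move: (m %/ L)%Z (m %% L)%Z => q' s'.
nia.
Qed.

Lemma mem_middle_cell z z' : (forall j, `|z j - z' j| <= L%:Z) ->
  middle_cell z z' \in owned_cells (block L z).
Proof.
move=> zz'; have sub i := middle_cell_subcube i zz'.
rewrite mem_filter; apply/andP; split.
  apply/eqP/ffunP => i; rewrite [LHS]ffunE [middle_cell z z' i]ffunE.
  move: (sub i); move: (block L z i) (midpoint z z' i) => b m.
  move qE : (m %/ L)%Z => q sub012; rewrite [3 * m]mulrC divzMDl// modzMDl.
  by rewrite [((_ + 1) %/ 3)%Z]divz_small ?modz_small ?addr0 ?qE; lia.
apply/mem_int_box => i; rewrite [middle_cell z z' i]ffunE.
have -> : [ffun i => 3 * L%:Z * (block L z i - 1)] i = 3 * L%:Z * (block L z i - 1).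
  by rewrite ffunE.
move: (sub i); move: (block L z i) (midpoint z z' i) => b m.
have := divz_eq m L; have := @modz_ge0 m L; have := @ltz_pmod m L.
move: (m %/ L)%Z (m %% L)%Z => q s h1 h2 h3 h4.
have : [|| q == b - 1, q == b | q == b + 1] by lia.
by case/or3P => /eqP qE; subst q; lia.
Qed.

Lemma middle_cell_midpoint eps z z' (p : 'rV[R]_d) : 0 < eps -> (forall j, `|z j - z' j| <= L%:Z) ->
  cube (eps / 3) (middle_cell z z') p ->
  forall i, eps * (midpoint z z' i)%:~R <= p ord0 i <= eps * (midpoint z z' i)%:~R + eps.
Proof.
move=> eps0 zz' zp i; have := zp i.
have := middle_cell_subcube i zz'; rewrite [middle_cell z z' i]ffunE.
move: (block L z i - _ + 1) => t; move: (midpoint z z' i) => m /andP[t0 t2]; rewrite intrD intrM.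
have : 0 <= eps * t%:~R by rewrite mulr_ge0 ?ler0z// ltW.
have : eps * t%:~R <= eps * 2 by rewrite ler_pM2l// (ler_int _ _ 2).
have -> : eps / 3 * (3%:~R * m%:~R + t%:~R) = eps * m%:~R + eps * t%:~R / 3 by field.
move=> h1 h2 /andP[h3 h4]; apply/andP; split; lra.
Qed.

(** Scaling by [eps / (2 * a)] sends [u - v] to about [eps * (z - z') / 2], which is about [x - p].
    The rounding error is at most [2 * eps] per coordinate; the contraction factor [eps / a] leaves
    room for it. *)
Lemma midpoint_close eps a r z z' (x p u v : 'rV[R]_d) : 0 < eps -> 0 < a -> 0 <= r ->
  eps / a * r + 2 * d%:R * eps <= r ->
  (forall i, eps * (midpoint z z' i)%:~R <= p ord0 i <= eps * (midpoint z z' i)%:~R + eps) ->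
  cube eps z x -> cube a z u -> cube a z' v -> enorm (u - v) <= 2 * r -> enorm (x - p) <= r.
Proof.
move=> eps0 a0 r0 le_r mp zx zu zv uv.
pose k := eps / (2 * a); have k0 : 0 < k by rewrite divr_gt0// mulr_gt0.
rewrite (_ : x - p = k *: (u - v) + (x - p - k *: (u - v))); last by rewrite [RHS]addrC subrK.
apply: le_trans (enormD _ _) _; rewrite enormZ; last exact: ltW.
apply: (le_trans _ le_r); apply: lerD.
  rewrite (_ : eps / a * r = k * (2 * r)); first by rewrite ler_pM2l.
  by rewrite /k; field; rewrite gt_eqF.
rewrite [2 * _]mulrC -mulrA; apply: enorm_le => [|i]; first by rewrite mulr_ge0// ltW.
rewrite !mxE.
have /andP[p1 p2] := mp i; have /andP[x1 x2] := zx i.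
have ka : k * a = eps / 2 by rewrite /k; field; rewrite gt_eqF.
have kcube (c : int) (t : R) : a * c%:~R <= t < a * c%:~R + a ->
    eps * c%:~R / 2 <= k * t <= eps * c%:~R / 2 + eps / 2.
  move=> /andP[h1 /ltW h2].
  have -> : eps * c%:~R / 2 = k * (a * c%:~R) by rewrite mulrA ka mulrAC.
  by rewrite -ka -mulrDr !ler_pM2l// h1.
have /andP[u1 u2] := kcube _ _ (zu i); have /andP[v1 v2] := kcube _ _ (zv i).
have : eps * (midpoint z z' i * 2)%:~R <= eps * (z i + z' i)%:~R <=
    eps * (midpoint z z' i * 2 + 1)%:~R.
  by rewrite !ler_pM2l// !ler_int midpoint_le.
rewrite !intrD !mulrDr mulr1z mulr1 => /andP[m1 m2].
rewrite mulrN ler_norml; apply/andP; split; lra.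
Qed.

(** One point [sel z] of [X] is chosen per cube. For consecutive cubes on a lattice path, the middle
    cell reserved by the block of the first contains a point of [Y] within [r] of both chosen
    points. *)
Lemma bipartite_percolates eps a r X Y : 0 < eps -> 0 < a -> 0 <= r ->
  eps / a * r + 2 * d%:R * eps <= r -> 2 * r / a + 1 <= L%:R ->
  percolates (close_cubes a (2 * r)) (fun z => occupied_sites X eps z /\
    (forall y, y \in owned_cells (block L z) -> occupied_sites Y (eps / 3) y)) ->
  has_infinite_component (bipartite_geometric_graph X Y r).
Proof.
move=> eps0 a0 r0 le_r aL [M /far_path_reachable[z0]].
set A := fun z => _ => Az0 inf.
have Eclose := @close_cubes_le R d a (2 * r) L a0 aL.
have /choice[sel selP] : forall z : site, exists x, A z -> X x /\ cube eps z x.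
  move=> z.
  have [[[x Xx zx] _]|nAz] := pselect (A z); first by exists x.
  by exists 0.
have step z z' : A z -> A z' -> close_cubes a (2 * r) z z' ->
    component (bipartite_geometric_graph X Y r) (inl (sel z)) (inl (sel z')).
  move=> Az Az' zz'; have zz'L := Eclose _ _ zz'.
  have [p Yp /(middle_cell_midpoint eps0 zz'L) mp] := Az.2 _ (mem_middle_cell zz'L).
  have /asboolP[u [v [zu zv uv]]] := zz'.
  have [Xz zz] := selP _ Az; have [Xz' zz''] := selP _ Az'.
  apply: (@component_trans _ _ _ (inr p)); apply: component_adj; split => //.
    exact: midpoint_close le_r mp zz zu zv uv.
  (* The midpoint is symmetric in the two cubes, so the same estimate serves for the second one. *)
  have vu : enorm (v - u) <= 2 * r by rewrite -enormN opprB.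
  apply: midpoint_close le_r _ zz'' zv zu vu => // i.
  by have := mp i; rewrite !ffunE [z i + _]addrC.
exists (inl (sel z0)); first by have [] := selP _ Az0.
pose back (v : 'rV[R]_d + 'rV[R]_d) : site := if v is inl x then cube_of eps x else z0.
move=> fin; apply: inf; apply: sub_finite_set (finite_image back fin) => _ [p [z0p Ap] <-].
exists (inl (sel (last z0 p))).
  elim: p z0 z0p Ap {Az0 back fin} => [|z p IH] z0 /=; first by exists [::].
  move=> /andP[z0z zp] Ap; apply: component_trans (IH _ zp _).
    by apply: step => //; apply: Ap; rewrite !inE ?eqxx ?orbT.
  by move=> y yp; apply: Ap; rewrite inE yp orbT.
have [_ zz] := selP _ (Ap _ (mem_last _ _)).
exact: cube_inj eps0 (cube_cube_of _ eps0) zz.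
Qed.

End Cells.

End BipartiteGeometry.

(** Bounds the probability that some cell among [n] independent reserved ones is empty. *)
Lemma bernoulli_inequality {R : realFieldType} (q : R) n : 0 <= q <= 1 ->
  1 - q ^+ n <= n%:R * (1 - q).
Proof.
move=> /andP[q0 q1]; elim: n => [|n IH]; first by rewrite expr0 subrr mul0r.
have qn0 : 0 <= q ^+ n by rewrite exprn_ge0.
have qn1 : q ^+ n <= 1 by rewrite exprn_ile1.
by rewrite exprS -natr1; nra.
Qed.

(** * Upper bound on the critical intensity at fixed scales *)

Section CriticalBound.
Context {R : realType} {d : nat} {dO : measure_display} {Omega : measurableType dO}
  (Pr : probability Omega R).
Local Notation site := {ffun 'I_d -> int}.

Lemma independent_occupied_sum (N N' : Omega -> set 'rV[R]_d) (lam mu a b : R) :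
  (0 < d)%N -> 0 < lam -> 0 < mu -> 0 < a -> 0 < b ->
  poisson_process Pr lam N -> poisson_process Pr mu N' -> independent_processes Pr N N' ->
  independent_events Pr (sum_fam (occupied N a) (occupied N' b))
    (sum_fam (fun=> 1 - expR (- (lam * a ^+ d))) (fun=> 1 - expR (- (mu * b ^+ d)))).
Proof.
move=> d0 lam0 mu0 a0 b0 poisN poisN' indep; apply: independent_events_sum.
- exact: independent_occupied.
- exact: independent_occupied.
- by move=> s t; apply: indep; exact: process_sigma_algebra_all_occur.
Qed.

(** Distinct blocks own disjoint sets of cells, so their erasures are independent of one another and
    of the occupied sites. *)
Lemma independent_occupied_cells (A B : site -> set Omega) (p q : R) L :
  independent_events Pr (sum_fam A B) (sum_fam (fun=> p) (fun=> q)) ->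
  independent_events Pr (sum_fam A (fun b => all_occur B (owned_cells L b)))
    (sum_fam (fun=> p) (fun b => q ^+ size (owned_cells L b))).
Proof.
pose F (x : site + site) : seq (site + site) :=
  match x with inl z => [:: inl z] | inr b => map inr (owned_cells L b) end.
move=> /(@independent_events_grouped _ _ _ _ _ _ _ _ F) indF.
have -> : sum_fam A (fun b => all_occur B (owned_cells L b)) =
    fun i => all_occur (sum_fam A B) (F i).
  apply/funext => -[z|b] /=.
    apply/seteqP; split => [w Az i|w Az]; first by rewrite inE => /eqP ->.
    by apply: (Az (inl z)); rewrite inE.
  apply/seteqP; split => w Bw; first by move=> i /mapP[y yb ->]; exact: Bw.
  by move=> y yb; apply: (Bw (inr y)); rewrite map_f.
have -> : sum_fam (fun=> p) (fun b => q ^+ size (owned_cells L b)) =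
    fun i => \prod_(x <- F i) sum_fam (fun=> p) (fun=> q) x.
  apply/funext => -[z|b] /=; first by rewrite big_seq1.
  rewrite big_map /=; elim: (owned_cells L b) => [|y s IH]; first by rewrite big_nil.
  by rewrite big_cons exprS IH.
apply: indF => [[z|b]|[z|b] [z'|b'] x] //=.
- by rewrite map_inj_uniq ?owned_cells_uniq// => ? ? [].
- by rewrite !inE => /eqP -> /eqP [->].
- by rewrite inE => /eqP -> /mapP[].
- by move=> /mapP[y _ ->]; rewrite inE.
- by move=> /mapP[y yb ->] /mapP[y' y'b [yy']]; congr inr; apply: owned_cells_inj yb _; rewrite yy'.
Qed.

(** The last premise bounds the expected number of empty reserved cells of a block, hence its
    erasure probability, by the tolerance of [percolation_transfer]. *)
Lemma mu_c_le (P Q : R -> Omega -> set 'rV[R]_d) (r lam lam' mu eps a : R) (L : nat) :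
  (0 < d)%N -> 0 < lam' -> 0 < mu -> 0 < eps -> 0 < a -> 0 <= r ->
  poisson_process Pr lam (P lam) -> poisson_process Pr lam' (P lam') ->
  poisson_process Pr mu (Q mu) -> independent_processes Pr (P lam) (Q mu) ->
  {ae Pr, forall w, has_infinite_component (geometric_graph (P lam' w) (2 * r))} ->
  eps / a * r + 2 * d%:R * eps <= r -> 2 * r / a + 1 <= L%:R ->
  lam' * a ^+ d < lam * eps ^+ d ->
  let p' := 1 - expR (- (lam' * a ^+ d)) in
  let p := 1 - expR (- (lam * eps ^+ d)) in
  ((9 * L) ^ d)%:R * expR (- (mu * (eps / 3) ^+ d)) <= (1 - p') ^+ (L ^ d) * (1 - p' / p) ->
  (mu_c Pr P Q r lam <= mu%:E)%E.
Proof.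
move=> d0 lam'0 mu0 eps0 a0 r0 poisP poisP' poisQ indPQ perc le_r aL lam_lt p' p.
set q := expR (- (mu * _)) => le_q.
have eps30 : 0 < eps / 3 by rewrite divr_gt0.
have lam0 : 0 < lam.
  have : 0 < lam * eps ^+ d by apply: lt_trans lam_lt; rewrite mulr_gt0 ?exprn_gt0.
  by rewrite pmulr_lgt0 ?exprn_gt0.
have L0 : (0 < L)%N.
  rewrite -(ltr0n R); apply: lt_le_trans aL; rewrite ltr_wpDl// divr_ge0//; last exact: ltW.
  by rewrite mulr_ge0.
apply: ereal_inf_lbound; exists mu => //; split => //.
have q01 : 0 <= 1 - q <= 1.
  by rewrite subr_ge0 gerBl expR_ge0 andbT -expR0 ler_expR oppr_le0 mulr_ge0 ?exprn_ge0 ?ltW.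
have E_le := @close_cubes_le R d a (2 * r) L a0 aL.
have indP' := independent_occupied d0 lam'0 a0 poisP'.
have := independent_occupied_sum d0 lam0 mu0 eps0 eps30 poisP poisQ indPQ.
rewrite -/p -/p' -/q in indP' * => /(@independent_occupied_cells _ _ _ _ L) indPQ'.
have p'0 : 0 <= p'.
  by rewrite subr_ge0 -expR0 ler_expR oppr_le0 mulr_ge0 ?exprn_ge0 ?ltW.
have p'p : p' < p by rewrite ltrD2l ltrN2 ltr_expR ltrN2.
have p1 : p <= 1 by rewrite gerBl expR_ge0.
have perc' : {ae Pr, forall w,
    percolates (close_cubes a (2 * r)) (fun z => occupied (P lam') a z w)}.
  apply: filterS perc => w; apply: geometric_percolates => //; first by rewrite mulr_ge0.
  exact: (pp_locally_finite poisP').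
have := percolation_transfer L0 E_le indP' indPQ' p'0 p'p p1 _ _ perc'.
have g01 (b : site) : 0 <= (1 - q) ^+ size (owned_cells L b) <= 1.
  by case/andP: q01 => q0 q1; rewrite exprn_ge0//= exprn_ile1.
move=> /(_ g01) transfer; apply: filterS (transfer _) => [w|b].
  exact: bipartite_percolates.
apply: le_trans (bernoulli_inequality _ q01) _; rewrite subKr; apply: le_trans le_q.
by rewrite ler_wpM2r ?expR_ge0// ler_nat size_owned_cells.
Qed.

End CriticalBound.

(** * Choice of the scales *)

Section ScaleChoice.
Context {R : realType}.

(** The power is convex, hence below its chord on the unit interval. *)
Lemma expr1D_le (t : R) n : 0 <= t <= 1 -> (1 + t) ^+ n <= 1 + (2 ^+ n - 1) * t.
Proof.
move=> /andP[t0 t1]; elim: n => [|n IH]; first by rewrite !expr0 subrr mul0r addr0.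
have : 1 <= 2 ^+ n :> R by rewrite exprn_ege1// ler1n.
rewrite !exprS; move: IH; set u := _ ^+ n; set v := 2 ^+ n => IH v1.
apply: (@le_trans _ _ ((1 + t) * (1 + (v - 1) * t))).
  by apply: ler_wpM2l => //; lra.
rewrite -subr_ge0 [leRHS](_ : _ = (v - 1) * t * (1 - t)); last by ring.
by rewrite !mulr_ge0 ?subr_ge0.
Qed.

Lemma expR_le_power (y : R) n : 0 < y -> (0 < n)%N -> expR (- y) <= (n%:R / y) ^+ n.
Proof.
move=> y0 n0; have n0R : 0 < n%:R :> R by rewrite ltr0n.
have yE : y = n%:R * (y / n%:R) by rewrite mulrC divfK// gt_eqF.
have -> : (n%:R / y) ^+ n = ((y / n%:R) ^+ n)^-1 by rewrite -exprVn invf_div.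
rewrite expRN lef_pV2 ?posrE ?expR_gt0 ?exprn_gt0 ?divr_gt0//.
rewrite [in leRHS]yE expRM_natl; apply: lerXn2r; rewrite ?nnegrE ?expR_ge0//.
  by rewrite divr_ge0// ltW.
by apply: le_trans (expR_ge1Dx _); rewrite lerDr.
Qed.

(** The right-hand side is [(expR (- x') - expR (- x)) / (1 - expR (- x))], with numerator at least
    [expR (- x) * (x - x')] and denominator at most [x]. *)
Lemma occupation_ratio (x x' : R) : 0 <= x' -> x' < x ->
  expR (- x) * ((x - x') / x) <= 1 - (1 - expR (- x')) / (1 - expR (- x)).
Proof.
move=> x'0 xx'; have x0 : 0 < x by exact: le_lt_trans xx'.
have p0 : 0 < 1 - expR (- x) by rewrite subr_gt0 -expR0 ltr_expR oppr_lt0.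
have px : 1 - expR (- x) <= x by have := expR_ge1Dx (- x); lra.
have -> : 1 - (1 - expR (- x')) / (1 - expR (- x)) =
    (expR (- x') - expR (- x)) / (1 - expR (- x)) by field; rewrite gt_eqF.
rewrite mulrA; apply: (@le_trans _ _ (expR (- x) * (x - x') / (1 - expR (- x)))).
  rewrite ler_pM2l ?mulr_gt0 ?expR_gt0 ?subr_gt0// lef_pV2 ?posrE//.
rewrite ler_pM2r ?invr_gt0//.
have -> : expR (- x') = expR (- x) * expR (x - x') by rewrite -expRD; congr expR; ring.
by have := expR_ge1Dx (x - x'); have := expR_gt0 (- x); nra.
Qed.

(** Both [eps] and [a / eps - 1] are of order [delta]. The tolerance is then at least [c3 * delta],
    while [mu * eps ^+ d] is of order [delta ^- d * |ln delta|]: for every [eta] its exponential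
    beats the number of cells, of order [delta ^- d]. *)
Lemma admissible_scales (r lc eta : R) d : 0 < r -> 0 <= lc -> 0 < eta -> (0 < d)%N ->
  exists2 delta0 : R, 0 < delta0 & forall delta lam', 0 < delta -> delta < delta0 ->
    0 < lam' -> lam' < lc + delta / 2 ->
  exists eps a (L : nat),
    [/\ 0 < eps, 0 < a, eps / a * r + 2 * d%:R * eps <= r,
      2 * r / a + 1 <= L%:R & lam' * a ^+ d < (lc + delta) * eps ^+ d /\
      let p' := 1 - expR (- (lam' * a ^+ d)) in
      let p := 1 - expR (- ((lc + delta) * eps ^+ d)) in
      let mu := eta * (delta ^- (2 * d) * `|ln delta|) in
      ((9 * L) ^ d)%:R * expR (- (mu * (eps / 3) ^+ d)) <=
        (1 - p') ^+ (L ^ d) * (1 - p' / p)].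
Proof.
move=> r0 lc0 eta0 d0; have d0R : 0 < d%:R :> R by rewrite ltr0n.
have dge1 : 1 <= d%:R :> R by rewrite ler1n.
pose K := lc + 1; have K1 : 1 <= K by rewrite lerDr.
have K0 : 0 < K by lra.
pose T : R := 2 ^+ d; have T1 : 1 <= T by rewrite exprn_ege1// ler1n.
have T0 : 0 < T by lra.
(* Gives [K * (T * t) = delta / 4] for [t = c1 * delta]: enlarging [eps] to [a] costs at most
   [delta / 4] in intensity, and [delta / 4] remains as slack. *)
pose c1 := (4 * T * K)^-1.
have c10 : 0 < c1 by rewrite invr_gt0 !mulr_gt0.
have c11 : c1 <= 1 by rewrite invf_le1 ?mulr_gt0//; nra.
(* Gives [4 * d * eps = r * t], so the rounding error [2 * d * eps] equals [r * t / 2], at most the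
   gain [r - r / (1 + t)]. *)
pose c2 := r * c1 / (4 * d%:R); have c20 : 0 < c2 by rewrite divr_gt0 ?mulr_gt0.
(* The first factor bounds below the probability that a block, of side [a * L <= 3 * r], is empty;
   the second comes from [occupation_ratio]. *)
pose c3 := expR (- (K * (3 * r) ^+ d)) * (expR (- (K * r ^+ d)) / (4 * K)).
have c30 : 0 < c3 by rewrite mulr_gt0 ?divr_gt0 ?expR_gt0 ?mulr_gt0.
pose c4 := eta * (c2 / 3) ^+ d.
have c40 : 0 < c4 by apply: mulr_gt0 => //; apply: exprn_gt0; lra.
(* The exponential is bounded by a power of exponent [d.+2]: [d] factors [delta] cancel the number
   of cells and two remain, one more than in [c3 * delta]. *)
pose C5 := (27 * r / c2) ^+ d * ((d.+2)%:R / c4) ^+ d.+2.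
have C50 : 0 < C5.
  apply: mulr_gt0; apply: exprn_gt0; apply: divr_gt0 => //; lra.
(* The first bound ensures [1 <= |ln delta|], the second [C5 * delta ^+ 2 <= c3 * delta]. *)
exists (Num.min (expR (-1)) (c3 / C5)); first by rewrite lt_min expR_gt0 divr_gt0.
move=> delta lam' de0; rewrite lt_min => /andP[de1 deC] lam'0 lam'lt.
have expm1 : expR (-1) <= 1 :> R by rewrite -[leRHS]expR0 ler_expR oppr_le0.
have de1' : delta <= 1 by lra.
pose t := c1 * delta; have t0 : 0 < t by rewrite mulr_gt0.
have t1 : t <= 1 by rewrite /t; nra.
pose eps := c2 * delta; have eps0 : 0 < eps by rewrite mulr_gt0.
pose a := eps * (1 + t); have a0 : 0 < a by rewrite mulr_gt0//; lra.
have epsE : 4 * d%:R * eps = r * t.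
  by rewrite /eps /c2 /t; field; rewrite gt_eqF.
have eps_r : 4 * eps <= r by nra.
have a_eps : a <= 2 * eps by rewrite /a; nra.
have eps_a : eps <= a by rewrite /a; nra.
pose L := (Num.truncn (2 * r / a + 1)).+1.
have L1 : 2 * r / a + 1 <= L%:R by exact/ltW/truncnS_gt.
have L2 : L%:R <= 2 * r / a + 2.
  have /truncn_itv/andP[h _] : 0 <= 2 * r / a + 1.
    by rewrite addr_ge0// divr_ge0//; [lra|exact: ltW].
  by rewrite /L -natr1; lra.
have aL : a * L%:R <= 3 * r.
  apply: (@le_trans _ _ (a * (2 * r / a + 2))); first by rewrite ler_pM2l.
  have -> : a * (2 * r / a + 2) = 2 * r + 2 * a by field; rewrite gt_eqF.
  lra.
have lamK : lam' <= K by rewrite /K; lra.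
have lt1 : lam' * (1 + t) ^+ d <= lc + 3 / 4 * delta.
  have Tt : K * (T * t) = delta / 4.
    by rewrite /t /c1; field; rewrite !gt_eqF.
  have h : (1 + t) ^+ d <= 1 + T * t.
    apply: le_trans (expr1D_le _ _) _; first by rewrite ltW.
    by rewrite lerD2l ler_pM2r// gerBl.
  apply: (@le_trans _ _ (lam' * (1 + T * t))); first by rewrite ler_pM2l.
  have : lam' * (T * t) <= K * (T * t) by rewrite ler_pM2r// mulr_gt0.
  rewrite mulrDr mulr1; lra.
have ed0 : 0 < eps ^+ d by rewrite exprn_gt0.
have lt2 : lam' * a ^+ d <= (lc + delta) * eps ^+ d - delta / 4 * eps ^+ d.
  have -> : lam' * a ^+ d = lam' * (1 + t) ^+ d * eps ^+ d.
    by rewrite /a exprMn; ring.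
  rewrite -mulrBl ler_pM2r//; lra.
have de4 : 0 < delta / 4 * eps ^+ d by rewrite mulr_gt0// divr_gt0.
exists eps, a, L; split => //.
- have -> : eps / a * r = r / (1 + t) by rewrite /a; field; rewrite !gt_eqF//; lra.
  have : 2 * d%:R * eps <= r * t / (1 + t).
    have -> : 2 * d%:R * eps = r * t / 2 by lra.
    have rt0 : 0 < r * t by rewrite mulr_gt0.
    by rewrite ler_pdivlMr; [nra | lra].
  have -> : r / (1 + t) = r - r * t / (1 + t) by field; rewrite gt_eqF//; lra.
  lra.
- split; first lra.
  move=> p' p mu.
  apply: (@le_trans _ _ (c3 * delta)).
    have y0 : 0 < c4 / delta by rewrite divr_gt0.
    have -> : mu * (eps / 3) ^+ d = c4 * (delta ^- d * `|ln delta|).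
      have -> : (eps / 3) ^+ d = (c2 / 3) ^+ d * delta ^+ d.
        by rewrite -exprMn; congr (_ ^+ _); rewrite /eps; ring.
      rewrite /mu /c4 mul2n -addnn exprD.
      move: (c2 / 3) => c; move: `|ln delta| => l.
      by field; rewrite expf_neq0// gt_eqF.
    apply: (@le_trans _ _ ((27 * r / eps) ^+ d * expR (- (c4 / delta)))).
      apply: ler_pM; rewrite ?expR_ge0//.
        rewrite natrX natrM; apply: lerXn2r;
          rewrite ?nnegrE ?mulr_ge0 ?invr_ge0 ?(ltW eps0) ?(ltW r0)//.
        have : eps * L%:R <= 3 * r by apply: le_trans aL; rewrite ler_wpM2r.
        by rewrite ler_pdivlMr//; lra.
      rewrite ler_expR lerN2 ler_pM2l//.
      have ln1 : 1 <= `|ln delta|.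
        rewrite ler0_norm; last by apply: ln_le0; lra.
        by rewrite lerNr -[leRHS](expRK (-1)) ler_ln ?posrE ?expR_gt0// ltW.
      rewrite -[leLHS]mulr1; apply: ler_pM => //; first by rewrite invr_ge0 ltW.
      rewrite lef_pV2 ?posrE ?exprn_gt0//; case: (d) d0 => // n _.
      rewrite exprS -[leRHS]mulr1; apply: ler_pM => //; [exact: ltW|exact/exprn_ge0/ltW|].
      by apply: exprn_ile1 => //; exact: ltW.
    apply: (@le_trans _ _ (C5 * delta ^+ 2)).
      apply: le_trans (ler_wpM2l _ (expR_le_power y0 (ltn0Sn d.+1))) _.
        by apply: exprn_ge0; apply: divr_ge0; [lra|exact: ltW].
      rewrite le_eqVlt; apply/orP; left; apply/eqP.
      have -> : 27 * r / eps = 27 * r / c2 * delta^-1.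
        by rewrite /eps invfM mulrA.
      have -> : d.+2%:R / (c4 / delta) = d.+2%:R / c4 * delta.
        by rewrite invf_div mulrA mulrAC.
      rewrite /C5; move: (27 * r / c2) (d.+2%:R / c4) => u v.
      rewrite !exprMn exprVn.
      rewrite (_ : delta ^+ d.+2 = delta ^+ 2 * delta ^+ d); last by rewrite -exprD.
      have : delta ^+ d != 0 by rewrite expf_neq0// gt_eqF.
      move: (delta ^+ d) (u ^+ d) (v ^+ d.+2) => x y z x0.
      by field.
    rewrite expr2 mulrA ler_pM2r//.
    by move: deC; rewrite ltr_pdivlMr// mulrC => /ltW.
  rewrite /c3 -mulrA; apply: ler_pM; rewrite ?expR_ge0//.
  + by rewrite mulr_ge0 ?divr_ge0 ?expR_ge0 ?mulr_ge0 ?ltW.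
  + rewrite /p' subKr -expRM_natl ler_expR mulrN lerN2 natrX.
    have -> : L%:R ^+ d * (lam' * a ^+ d) = lam' * (a * L%:R) ^+ d.
      by rewrite [in RHS]exprMn mulrC -mulrA.
    have aL0 : 0 <= a * L%:R by rewrite mulr_ge0// ltW.
    apply: ler_pM => //; [exact: ltW|exact: exprn_ge0|].
    by apply: lerXn2r; rewrite ?nnegrE//; lra.
  + apply: le_trans (occupation_ratio _ _); last 2 first.
    * by rewrite mulr_ge0 ?exprn_ge0 ?ltW.
    * lra.
    rewrite -mulrA; apply: ler_pM; rewrite ?expR_ge0//.
    * by rewrite mulr_ge0 ?invr_ge0 ?mulr_ge0 ?ltW.
    * rewrite ler_expR lerN2; apply: ler_pM; [lra|exact: ltW|by rewrite /K; lra|].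
      by apply: lerXn2r; rewrite ?nnegrE; lra.
    * have x0 : 0 < (lc + delta) * eps ^+ d by rewrite mulr_gt0//; lra.
      rewrite ler_pdivlMr//.
      have xK : (lc + delta) * eps ^+ d <= K * eps ^+ d by rewrite ler_pM2r// /K; lra.
      have k0 : 0 <= (4 * K)^-1 * delta.
        by rewrite mulr_ge0 ?invr_ge0 ?mulr_ge0 ?(ltW K0) ?(ltW de0).
      apply: le_trans (ler_wpM2l k0 xK) _.
      rewrite (_ : _ * (K * _) = delta / 4 * eps ^+ d); first lra.
      by field; rewrite gt_eqF.
Qed.

End ScaleChoice.

(** * Percolation at high intensity *)

Section Renormalization.
Implicit Types (u v s t b z : nat * nat) (op : nat * nat -> Prop) (k : nat).

Definition grid : seq (nat * nat) := [seq (i, j) | i <- iota 0 3, j <- iota 0 3].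

Definition sub_block v s : nat * nat := ((3 * v.1 + s.1)%N, (3 * v.2 + s.2)%N).

Definition next_to u v := (v == (u.1.+1, u.2)) || (v == (u.1, u.2.+1)).

Fixpoint good op k v : Prop :=
  if k is k'.+1 then
    exists b, forall s, s \in grid -> s != b -> good op k' (sub_block v s)
  else op v.

Fixpoint main_part op k v : set (nat * nat) :=
  if k is k'.+1 then
    [set z | exists s, [/\ s \in grid, good op k' (sub_block v s) &
                         main_part op k' (sub_block v s) z]]
  else [set v].

Lemma next_to_sub_block v s t : next_to s t -> next_to (sub_block v s) (sub_block v t).
Proof.
case: v s t => [v1 v2] [s1 s2] [t1 t2]; rewrite /next_to /sub_block /= !xpair_eqE.
lia.
Qed.

Definition grow b (S : seq (nat * nat)) :=
  [seq t <- grid | (t != b) && has (fun s => [|| s == t, next_to s t | next_to t s]) S].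

(** The point [(3, 3)] lies outside the grid and encodes that nothing is removed. Eight rounds
    suffice for nine cells; the finitely many cases are computed. *)
Lemma grid_minus_point_connected b s t : b \in (3, 3)%N :: grid -> s \in grid -> t \in grid ->
  s != b -> t != b -> t \in iter 8 (grow b) [:: s].
Proof.
have : all (fun b => all (fun s => all (fun t =>
  [|| s == b, t == b | t \in iter 8 (grow b) [:: s]]) grid) grid) ((3, 3)%N :: grid).
  by vm_compute.
move=> /allP allb bg sg tg /negbTE sb /negbTE tb.
by have /allP/(_ s sg)/allP/(_ t tg) := allb b bg; rewrite sb tb.
Qed.

(** Normalizes the exception: it is the unique bad subblock if there is one, and [(3, 3)]
    otherwise. *)
Lemma good_exception op k v : good op k.+1 v -> exists b,
  b \in (3, 3)%N :: grid /\
  forall s, s \in grid -> (good op k (sub_block v s) <-> s != b).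
Proof.
move=> [b gb]; have [badb|okb] := pselect (b \in grid /\ ~ good op k (sub_block v b)).
  exists b; split=> [|s sg]; first by rewrite inE badb.1 orbT.
  split=> [gs|]; last exact: gb.
  by apply: contraPneq gs => ->; exact: badb.2.
exists (3, 3)%N; split=> // s sg; split=> [_|_]; first by apply: contraTneq sg => ->.
have [sb|] := eqVneq s b; last exact: gb.
by apply: contrapT => nb; apply: okb; rewrite -sb.
Qed.

Section Connection.
Variables (op : nat * nat -> Prop) (C : nat * nat -> nat * nat -> Prop).
Hypothesis C_refl : forall u, op u -> C u u.
Hypothesis C_sym : forall u v, C u v -> C v u.
Hypothesis C_trans : forall u v w, C u v -> C v w -> C u w.
Hypothesis C_next : forall u v, op u -> op v -> next_to u v -> C u v.

Let linked k u v := forall x y, main_part op k u x -> main_part op k v y -> C x y.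

Lemma main_part_nonempty k v : good op k v -> main_part op k v !=set0.
Proof.
elim: k v => [|k IH] v; first by exists v.
move=> /good_exception[b [bg gb]].
have [s sg sb] : exists2 s, s \in grid & s != b.
  by have [->|] := eqVneq b (0, 0)%N; [exists (1, 0)%N|exists (0, 0)%N; rewrite // eq_sym].
have gs := (gb s sg).2 sb; have [z zs] := IH _ gs.
by exists z, s.
Qed.

Lemma linked_trans k u v w : good op k v -> linked k u v -> linked k v w -> linked k u w.
Proof.
move=> /main_part_nonempty[y yv] uv vw x z xu zw.
exact: C_trans (uv _ _ xu yv) (vw _ _ yv zw).
Qed.

Lemma linked_sym k u v : linked k u v -> linked k v u.
Proof. by move=> uv x y xv yu; apply/C_sym/uv. Qed.

(** Joint induction on the scale. Inside a good block, the good subblocks form a connected part of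
    the grid; two neighbouring good blocks have three facing pairs of subblocks, and their two
    exceptions spoil at most two. *)
Lemma good_linked k : (forall v, good op k v -> linked k v v) /\
  (forall u v, good op k u -> good op k v -> next_to u v -> linked k u v).
Proof.
elim: k => [|k [IH1 IH2]].
  split=> [v ov x y -> ->|u v ou ov uv x y -> ->]; [exact: C_refl|exact: C_next].
have self v : good op k.+1 v -> linked k.+1 v v.
  move=> /good_exception[b [bg gb]] x y [s [sg gs xs]] [t [tg gt yt]].
  have sb := (gb s sg).1 gs.
  suff : [/\ t \in grid, t != b & linked k (sub_block v s) (sub_block v t)].
    by move=> [_ _ st]; exact: st.
  have := grid_minus_point_connected bg sg tg sb ((gb t tg).1 gt).
  elim: 8%N t {tg gt yt} => [|n IH] t /=.
    by rewrite inE => /eqP ->; split => //; exact: IH1.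
  rewrite mem_filter => /andP[/andP[tb /hasP[t' /IH[t'g t'b st'] tt']] tg]; split => //.
  have gt' := (gb t' t'g).2 t'b; have gt := (gb t tg).2 tb.
  apply: (linked_trans gt' st'); move: tt' => /or3P[/eqP <-|tt'|tt'].
  - exact: (IH1 _ gt').
  - by apply: IH2 => //; exact: next_to_sub_block.
  - by apply/linked_sym/IH2 => //; exact: next_to_sub_block.
split => // u v gu gv uv.
suff [s [t [gs gt st]]] : exists s t, [/\ s \in grid /\ good op k (sub_block u s),
    t \in grid /\ good op k (sub_block v t) & next_to (sub_block u s) (sub_block v t)].
  have [[sg gs'] [tg gt']] := (gs, gt).
  have [p ps] := main_part_nonempty gs'; have [q qt] := main_part_nonempty gt'.
  move=> x y xu yv; apply: (C_trans (self _ gu _ p xu _)); first by exists s.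
  apply: (C_trans (IH2 _ _ gs' gt' st _ _ ps qt)).
  by apply: (self _ gv) => //; exists t.
have [b [_ gb]] := good_exception gu; have [b' [_ gb']] := good_exception gv.
have pick m n : exists2 j, j \in iota 0 3 & (j != m) && (j != n).
  have [m0|] := boolP ((0 != m) && (0 != n))%N; first by exists 0%N.
  have [m1 _|] := boolP ((1 != m) && (1 != n))%N; first by exists 1%N.
  by exists 2%N => //; lia.
have grid_mem i j : i \in iota 0 3 -> j \in iota 0 3 -> (i, j) \in grid.
  by move=> ii jj; apply/allpairsP; exists (i, j).
have gu' i j : i \in iota 0 3 -> j \in iota 0 3 -> (i != b.1) || (j != b.2) ->
    (i, j) \in grid /\ good op k (sub_block u (i, j)).
  move=> ii jj ijb; split; first exact: grid_mem.
  by apply/gb; [exact: grid_mem|case: (b) ijb => b1 b2; rewrite xpair_eqE negb_and].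
have gv' i j : i \in iota 0 3 -> j \in iota 0 3 -> (i != b'.1) || (j != b'.2) ->
    (i, j) \in grid /\ good op k (sub_block v (i, j)).
  move=> ii jj ijb; split; first exact: grid_mem.
  by apply/gb'; [exact: grid_mem|case: (b') ijb => b1 b2; rewrite xpair_eqE negb_and].
case/orP: uv => /eqP vE.
- have [j j3 /andP[jb jb']] := pick b.2 b'.2.
  exists (2, j)%N, (0, j)%N.
  split; [by apply: gu'; rewrite ?jb ?orbT|by apply: gv'; rewrite ?jb' ?orbT|].
  by rewrite vE /next_to /sub_block /= !xpair_eqE; lia.
- have [j j3 /andP[jb jb']] := pick b.1 b'.1.
  exists (j, 2)%N, (j, 0)%N; split; [by apply: gu'; rewrite ?jb|by apply: gv'; rewrite ?jb'|].
  by rewrite vE /next_to /sub_block /= !xpair_eqE; lia.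
Qed.

End Connection.
End Renormalization.

(** * Counting the closed configurations that spoil a block *)

Section ClosedSets.
Implicit Types (u v s t b z : nat * nat) (l : seq (nat * nat)) (op : nat * nat -> Prop) (k : nat).

Definition grid_pairs := [seq p <- [seq (s, t) | s <- grid, t <- grid] | p.1 != p.2].

(* If the block [v] of scale [k] is not good, then all the sites of one of these
   sets are closed: a bad block contains two bad subblocks. *)
Fixpoint closed_sets k v : seq (seq (nat * nat)) :=
  if k is k'.+1 then
    flatten [seq [seq l1 ++ l2 | l1 <- closed_sets k' (sub_block v p.1),
                                 l2 <- closed_sets k' (sub_block v p.2)] | p <- grid_pairs]
  else [:: [:: v]].

Lemma closed_setsS k v : closed_sets k.+1 v =
  flatten [seq [seq l1 ++ l2 | l1 <- closed_sets k (sub_block v p.1),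
                               l2 <- closed_sets k (sub_block v p.2)] | p <- grid_pairs].
Proof. by []. Qed.

Lemma not_good_closed_sets op k v : ~ good op k v ->
  exists2 l, l \in closed_sets k v & forall z, z \in l -> ~ op z.
Proof.
elim: k v => [|k IH] v.
  by move=> nopv; exists [:: v]; rewrite ?mem_seq1// => z; rewrite mem_seq1 => /eqP ->.
move=> nogood.
have bad b : exists s, [/\ s \in grid, s != b & ~ good op k (sub_block v s)].
  apply: contrapT => nobad; apply: nogood; exists b => s sg sb.
  by apply: contrapT => ngs; apply: nobad; exists s.
have [s [sg _ /IH[l1 l1s c1]]] := bad (3, 3)%N.
have [t [tg ts /IH[l2 l2t c2]]] := bad s.
exists (l1 ++ l2); last by move=> z; rewrite mem_cat => /orP[/c1|/c2].
rewrite closed_setsS.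
apply/flatten_mapP; exists (s, t); last by apply/allpairsP; exists (l1, l2).
rewrite mem_filter eq_sym; apply/andP; split=> //.
by apply/allpairsP; exists (s, t).
Qed.

Definition in_block k v z := ((z.1 %/ 3 ^ k)%N == v.1) && ((z.2 %/ 3 ^ k)%N == v.2).

Lemma grid_lt3 s : s \in grid -> (s.1 < 3)%N && (s.2 < 3)%N.
Proof. by move=> /allpairsP[[i j] [+ + ->]]; rewrite !mem_iota => /= -> ->. Qed.

Lemma in_sub_block k v s z : s \in grid -> in_block k (sub_block v s) z ->
  in_block k.+1 v z /\ s = ((z.1 %/ 3 ^ k) %% 3, (z.2 %/ 3 ^ k) %% 3)%N.
Proof.
move=> /grid_lt3; case: s => [s1 s2] /= /andP[s13 s23] /andP[/eqP /= z1 /eqP /= z2].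
rewrite /in_block z1 z2 expnSr !divnMA z1 z2; split.
  by apply/andP; split; apply/eqP; lia.
by congr (_, _); lia.
Qed.

Lemma closed_sets_block k v l z : l \in closed_sets k v -> z \in l -> in_block k v z.
Proof.
elim: k v l => [|k IH] v l; last rewrite closed_setsS.
  by rewrite mem_seq1 => /eqP ->; rewrite mem_seq1 => /eqP ->; rewrite /in_block expn0 !divn1 !eqxx.
move=> /flatten_mapP[[s t]]; rewrite mem_filter => /andP[_ /allpairsP[[s' t'] [/= sg tg [-> ->]]]].
move=> /allpairsP[[l1 l2] [/= l1s l2t ->]]; rewrite mem_cat => /orP[zl|zl].
  by have [] := in_sub_block sg (IH _ _ l1s zl).
by have [] := in_sub_block tg (IH _ _ l2t zl).
Qed.

(** Distinct subblocks cover disjoint regions, so the two halves share no site; independence then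
    applies to all [2 ^ k] of them. *)
Lemma closed_sets_uniq k v l : l \in closed_sets k v -> uniq l /\ size l = (2 ^ k)%N.
Proof.
elim: k v l => [|k IH] v l; last rewrite closed_setsS; first by rewrite mem_seq1 => /eqP ->.
move=> /flatten_mapP[[s t]]; rewrite mem_filter => /andP[st /allpairsP[[s' t'] [/= sg tg [sE tE]]]].
move: st; rewrite sE tE => st.
move=> /allpairsP[[l1 l2] [/= l1s l2t ->]].
have [u1 z1] := IH _ _ l1s; have [u2 z2] := IH _ _ l2t.
split; last by rewrite size_cat z1 z2 expnS mul2n addnn.
rewrite cat_uniq u1 u2 andbT /=; apply/hasPn => z zl2; apply/negP => zl1.
have [_ s'E] := in_sub_block sg (closed_sets_block l1s zl1).
have [_ t'E] := in_sub_block tg (closed_sets_block l2t zl2).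
by move: st; rewrite s'E -t'E eqxx.
Qed.

(** With at most 81 pairs, the count [n] at one scale becomes at most [81 * n ^ 2] at the next;
    multiplied by 81, it is at most squared. *)
Lemma size_closed_sets k v : (81 * size (closed_sets k v) <= 81 ^ (2 ^ k))%N.
Proof.
elim: k v => [|k IH] v //.
have [m mk sz] : exists2 m, (81 * m <= 81 ^ (2 ^ k))%N & forall u, (size (closed_sets k u) <= m)%N.
  exists (81 ^ (2 ^ k) %/ 81)%N; first by rewrite mulnC leq_trunc_div.
  by move=> u; rewrite leq_divRL// mulnC.
apply: (@leq_trans ((81 * m) ^ 2)%N); last first.
  by rewrite (expnSr 2 k) expnM leq_exp2r.
rewrite closed_setsS size_flatten /shape -map_comp sumnE big_map.
apply: (@leq_trans (81 * \sum_(p <- grid_pairs) (m * m))%N).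
  rewrite leq_mul2l /=; apply: leq_sum => p _ /=.
  by rewrite size_allpairs leq_mul.
rewrite big_const_seq iter_addn_0 count_predT.
have : (size grid_pairs <= 81)%N by [].
by nia.
Qed.

Lemma main_part_block op k v z : main_part op k v z -> in_block k v z.
Proof.
elim: k v => [|k IH] v /=; first by move=> ->; rewrite /in_block expn0 !divn1 !eqxx.
by move=> [s [sg _ /IH zs]]; have [] := in_sub_block sg zs.
Qed.

End ClosedSets.

(** * Good blocks at all large scales, by Borel-Cantelli *)

Section EventuallyGood.
Context {R : realType} {dO : measure_display} {Omega : measurableType dO}
  (Pr : probability Omega R).

Lemma probability_exists_le (T : eqType) (F : T -> set Omega) (s : seq T) (c : R) :
  (forall i, measurable (F i)) -> (forall i, i \in s -> Pr (F i) <= c%:E)%E ->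
  measurable [set w | exists2 i, i \in s & F i w] /\
  (Pr [set w | exists2 i, i \in s & F i w] <= ((size s)%:R * c)%:E)%E.
Proof.
move=> mF; elim: s => [|i s IH] Fc.
  rewrite (_ : [set _ | _] = set0); last by apply/seteqP; split => // w [].
  by split => //; rewrite measure0 mul0r.
have /IH[mS leS] : forall j, j \in s -> (Pr (F j) <= c%:E)%E.
  by move=> j js; apply: Fc; rewrite inE js orbT.
rewrite (_ : [set _ | _] = F i `|` [set w | exists2 i, i \in s & F i w]); last first.
  apply/seteqP; split => w.
    by move=> [j]; rewrite inE => /orP[/eqP ->|js] Fj; [left|right; exists j].
  by move=> [Fi|[j js Fj]]; [exists i; rewrite ?mem_head|exists j; rewrite // inE js orbT].
split; first exact: measurableU.
apply: le_trans (measureU2 _ _ _) _ => //=.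
rewrite -natr1 mulrDl mul1r EFinD addeC; apply: leeD => //.
by apply: Fc; rewrite mem_head.
Qed.

(** By the union bound over closed sets, the block of scale [k] at the origin is bad with
    probability at most [(81 * e) ^+ (2 ^ k)], which is summable. *)
Lemma eventually_good (Cl : nat * nat -> set Omega) (e : R) :
  independent_events Pr Cl (fun=> e) -> 0 <= e -> 81 * e <= 2^-1 ->
  {ae Pr, forall w, exists K, forall k, (K <= k)%N -> good (fun z => ~ Cl z w) k (0, 0)%N}.
Proof.
move=> [mCl indCl] e0 e81.
pose Z k := [set w | exists2 l, l \in closed_sets k (0, 0)%N & all_occur Cl l w].
(* The bound [2 ^- k] is written in the form that [epsilon_trick0] sums. *)
have Zle k : measurable (Z k) /\ (Pr (Z k) <= (2 / (2 ^ k.+1)%:R)%:E)%E.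
  have [|mZ leZ] := probability_exists_le (c := e ^+ (2 ^ k))
    (s := closed_sets k (0, 0)%N) (fun l => measurable_all_occur l mCl).
    move=> l /closed_sets_uniq[ul <-]; rewrite indCl// lee_fin.
    by elim: (l) => [|z s IH]; rewrite ?big_nil// big_cons exprS ler_wpM2l.
  split => //; apply: le_trans leZ _; rewrite lee_fin.
  apply: (@le_trans _ _ ((81 * e) ^+ (2 ^ k))).
    rewrite exprMn; apply: ler_wpM2r; first exact: exprn_ge0.
    have := size_closed_sets k (0, 0)%N; rewrite -(ler_nat R) natrM natrX.
    have : 0 <= (size (closed_sets k (0, 0)%N))%:R :> R by []. lra.
  apply: (@le_trans _ _ (2^-1 ^+ (2 ^ k))).
    by apply: lerXn2r; rewrite ?nnegrE//; lra.
  have -> : 2 / (2 ^ k.+1)%:R = 2^-1 ^+ k :> R.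
    by rewrite natrX exprS invfM mulrA divff// mul1r exprVn.
  by apply: ler_wiXn2l; rewrite ?invr_ge0 ?invf_le1 ?ler1n// ltnW// ltn_expl.
have lim0 : Pr (lim_sup_set Z) = 0%E.
  apply: lim_sup_set_cvg0 => [k|]; first exact: (Zle k).1.
  apply: le_lt_trans (lee_nneseries _ (fun n _ => (Zle n).2)) _ => //.
  apply: le_lt_trans (epsilon_trick0 _ _) _ => //; exact: ltry.
exists (lim_sup_set Z); split => //.
  apply: bigcapT_measurable => n; apply: bigcup_measurable => j _.
  exact: (Zle j).1.
move=> w /= nogood n _; apply: contrapT => noZ; apply: nogood.
exists n => k nk; apply: contrapT => /not_good_closed_sets[l lk cl].
by apply: noZ; exists k => //; exists l => // z /cl /contrapT.
Qed.

End EventuallyGood.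

Lemma independent_events_inj {R : realType} {dO : measure_display} {Omega : measurableType dO}
    (Pr : probability Omega R) (S T : choiceType) (h : S -> T) (Ev : T -> set Omega)
    (pr : T -> R) : injective h ->
  independent_events Pr Ev pr -> independent_events Pr (Ev \o h) (pr \o h).
Proof.
move=> injh [mEv indEv]; split=> [i|s us]; first exact: mEv.
rewrite (_ : all_occur (Ev \o h) s = all_occur Ev (map h s)); last first.
  apply/seteqP; split => w Hw i; first by move=> /mapP[j js ->]; exact: Hw.
  by move=> js; apply: Hw; exact: map_f.
by rewrite indEv ?map_inj_uniq// big_map.
Qed.

(** * An infinite component in a coordinate plane *)

Section Supercritical.
Context {R : realType} {d : nat}.
Hypothesis d_ge2 : (2 <= d)%N.
Local Notation site := {ffun 'I_d -> int}.
Implicit Types (z : nat * nat) (X : set 'rV[R]_d).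

Definition planar_site z : site :=
  [ffun i : 'I_d => if i == 0%N :> nat then z.1%:Z else if i == 1%N :> nat then z.2%:Z else 0].

Lemma planar_site_inj : injective planar_site.
Proof.
move=> [x y] [x' y'] /ffunP E.
have := E (Ordinal (ltnW d_ge2)); have := E (Ordinal d_ge2).
by rewrite !ffunE /= => -[->] [->].
Qed.

Lemma main_part_open op k v z : main_part op k v z -> good op k v -> op z.
Proof.
elim: k v => [|k IH] v /=; first by move=> ->.
by move=> [s [_ gs zs]] _; exact: IH zs gs.
Qed.

(** The blocks at the origin are nested and good from scale [K] on, so a site [z0] of the main part
    at scale [K] stays in all later ones. It is thus linked to sites of arbitrarily large first
    coordinate. *)
Lemma good_infinite_component X (a rho : R) K : 0 < a -> d%:R * (2 * a) <= rho ->
  (forall k, (K <= k)%N ->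
     good (fun z => occupied_sites X a (planar_site z)) k (0, 0)%N) ->
  has_infinite_component (geometric_graph X rho).
Proof.
move=> a0 le_rho; set op := fun z => _ => gK.
have /choice[sel selP] : forall z : nat * nat, exists x, op z -> X x /\ cube a (planar_site z) x.
  move=> z; have [[x Xx zx]|nop] := pselect (op z); first by exists x.
  by exists 0.
pose G := geometric_graph X rho.
pose C u v := component G (sel u) (sel v) /\ component G (sel v) (sel u).
have C_refl u : op u -> C u u by move=> _; split; exists [::].
have C_sym u v : C u v -> C v u by case.
have C_trans u v w : C u v -> C v w -> C u w.
  by move=> [uv vu] [vw wv]; split; [exact: component_trans uv vw|exact: component_trans wv vu].
have C_next u v : op u -> op v -> next_to u v -> C u v.
  move=> ou ov uv; have [Xu uu] := selP _ ou; have [Xv vv] := selP _ ov.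
  have neq : sel u <> sel v.
    move=> E; have /planar_site_inj uvE : planar_site u = planar_site v.
      by apply: cube_inj a0 uu _; rewrite E.
    by move: uv; rewrite uvE /next_to; case: (v) => v1 v2 /=; rewrite !xpair_eqE; lia.
  have near1 : enorm (sel u - sel v) <= rho.
    apply: le_trans le_rho; apply: enorm_le => [|i]; first by rewrite mulr_ge0// ltW.
    have /andP[u1 u2] := uu i; have /andP[v1 v2] := vv i.
    rewrite !mxE.
    have : `|planar_site u i - planar_site v i| <= 1.
      rewrite !ffunE; move: uv; rewrite /next_to; case: (u) (v) => [u1' u2'] [v1' v2'].
      rewrite !xpair_eqE /=; case: ifP => _; [|case: ifP => _]; lia.
    rewrite -(ler_int R) intr_norm intrB ler_norml => /andP[h1 h2].
    by rewrite ler_norml; apply/andP; split; nra.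
  split; apply: component_adj; first by split.
  by split => //; [exact: nesym|rewrite -enormN opprB].
have linked k := (good_linked C_refl C_sym C_trans C_next k).1.
have [z0 z0K] := main_part_nonempty (gK K (leqnn K)).
have z0k k : (K <= k)%N -> main_part op k (0, 0)%N z0.
  elim: k => [|k IH]; first by rewrite leqn0 => /eqP K0; move: z0K; rewrite K0.
  rewrite leq_eqVlt => /orP[/eqP <-//|Kk].
  by exists (0, 0)%N; split; [|exact: gK|exact: IH].
have oz0 : op z0 by exact: main_part_open z0K (gK K (leqnn K)).
exists (sel z0); first by have [] := selP _ oz0.
pose back (x : 'rV[R]_d) : nat := `|cube_of a x (Ordinal (ltnW d_ge2))|%N.
move=> /(finite_image back)/finite_seqP[s sE].
(* Exceeds every first coordinate met by the component, supposed finite. *)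
pose k := maxn K (\max_(i <- s) i)%N.+1.
have Kk : (K <= k)%N by exact: leq_maxl.
have [b [_ gb]] := good_exception (gK k.+1 (leqW Kk)).
(* A good subblock away from the left column: its sites have first coordinate at least [3 ^ k]. *)
have [t [tg t1 tb]] : exists t, [/\ t \in grid, (1 <= t.1)%N & t != b].
  have [->|] := eqVneq b (1, 0)%N; [by exists (2, 2)%N|].
  by exists (1, 0)%N; split => //; rewrite eq_sym.
have gt := (gb t tg).2 tb.
have [z zt] := main_part_nonempty gt.
have zk1 : main_part op k.+1 (0, 0)%N z by exists t.
have oz : op z by exact: main_part_open zt gt.
have [z0z _] := linked k.+1 _ (gK _ (leqW Kk)) _ _ (z0k k.+1 (leqW Kk)) zk1.
have : z.1 \in s.
  suff : (back @` component G (sel z0)) z.1 by rewrite sE.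
  exists (sel z) => //; rewrite /back.
  have [_ zz] := selP _ oz.
  by rewrite -(cube_inj a0 zz (cube_cube_of _ a0)) ffunE /=.
have z1 : (3 ^ k <= z.1)%N.
  have /andP[/eqP zt1 _] := main_part_block zt.
  by rewrite -divn_gt0 ?expn_gt0// zt1 /=.
move=> zs; have : (z.1 <= \max_(i <- s) i)%N by by apply: (@leq_bigmax_seq _ _ _ id).
have : (k < 3 ^ k)%N by exact: ltn_expl.
have : (\max_(i <- s) i < k)%N by exact: leq_maxr.
lia.
Qed.

Lemma exists_percolation {dO : measure_display} {Omega : measurableType dO}
    (Pr : probability Omega R) (P : R -> Omega -> set 'rV[R]_d) (rho : R) : 0 < rho ->
  (forall lam, 0 < lam -> poisson_process Pr lam (P lam)) ->
  exists2 lam : R, 0 < lam &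
    {ae Pr, forall w, has_infinite_component (geometric_graph (P lam w) rho)}.
Proof.
move=> rho0 poisP.
have d0 : (0 < d)%N by exact: ltnW.
have d0R : 0 < d%:R :> R by rewrite ltr0n.
pose a := rho / (d%:R * 2); have a0 : 0 < a by rewrite divr_gt0 ?mulr_gt0.
have ad0 : 0 < a ^+ d by rewrite exprn_gt0.
(* A cube is then empty with probability [expR (- 162)], at most 1/162, and [81 * e <= 1/2]
   follows. *)
exists (162 / a ^+ d); first by rewrite divr_gt0.
set lam := 162 / _; have lam0 : 0 < lam by rewrite divr_gt0.
have := independent_occupied d0 lam0 a0 (poisP _ lam0).
have -> : lam * a ^+ d = 162 by rewrite divfK// gt_eqF.
move=> /independent_events_setC/(independent_events_inj planar_site_inj) indCl.
have e_small : 81 * (1 - (1 - expR (- 162))) <= 2^-1 :> R.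
  have : expR (- 162) <= (1%:R / 162) ^+ 1 :> R by exact: expR_le_power.
  rewrite expr1; lra.
have e_ge0 : 0 <= 1 - (1 - expR (- 162)) :> R by rewrite subKr expR_ge0.
apply: filterS (eventually_good indCl e_ge0 e_small) => w [K goodK].
apply: (good_infinite_component (K := K) a0) => [|k Kk].
  by rewrite /a le_eqVlt; apply/orP; left; apply/eqP; field; rewrite gt_eqF.
have := goodK k Kk; congr good; apply/funext => z; apply/propext.
by split=> [/contrapT|occ nocc].
Qed.

End Supercritical.

(** * Conclusion *)

Lemma volume_ge0 {R : realType} {d : nat} (A : set 'rV[R]_d) : (0 <= volume A)%E.
Proof.
apply: le_ereal_inf_tmp => _ [ab [leab _] <-]; apply: nneseries_ge0 => k _ _.
by rewrite lee_fin /box_volume prodr_ge0// => i _; rewrite subr_ge0.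
Qed.

Theorem theorem1 (R : realType) (d : nat) (hd : (2 <= d)%N) (r : R) (hr : 0 < r)
  (dO : measure_display) (Omega : measurableType dO) (Pr : probability Omega R)
  (P Q : R -> Omega -> set 'rV[R]_d)
  (hP : forall lam : R, 0 < lam -> poisson_process Pr lam (P lam))
  (hQ : forall mu : R, 0 < mu -> poisson_process Pr mu (Q mu))
  (hPQ : forall lam mu : R, 0 < lam -> 0 < mu ->
     independent_processes Pr (P lam) (Q mu)) :
  lambda_c_AB Pr P Q r = lambda_c Pr P (2 * r) /\
  let lc : R := fine (lambda_c Pr P (2 * r)) in
  (limf_esup
     (fun delta : R =>
        mu_c Pr P Q r (lc + delta)%R / (delta ^- (2 * d) * `|ln delta|)%R%:E)
     (0 : R)^'+
   <= ((4 * lc ^+ 2 / r) ^+ d * d%:R ^+ (3 * d) * d.+1%:R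
        * unit_ball_volume R d)%R%:E)%E.
Proof.
have d0 : (0 < d)%N by exact: ltnW.
set Lc := lambda_c Pr P (2 * r).
have Lc_ge0 : (0 <= Lc)%E.
  by apply: le_ereal_inf_tmp => _ [lam [lam0 _] <-]; rewrite lee_fin ltW.
(* Percolation at some intensity makes the critical value finite, so [fine] does not alter it. *)
have [lam1 lam10 perc1] := exists_percolation hd (mulr_gt0 (ltr0Sn R 1) hr) hP.
have Lc_lty : (Lc < +oo)%E.
  by apply: le_lt_trans (ltry lam1); apply: ereal_inf_lbound; exists lam1.
have Lc_fin : Lc \is a fin_num by rewrite ge0_fin_numE.
pose lc := fine Lc; have LcE : Lc = lc%:E by rewrite fineK.
have lc0 : 0 <= lc by exact: fine_ge0.
have adherent t : 0 < t -> exists lam', [/\ 0 < lam', lam' < lc + t &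
    {ae Pr, forall w, has_infinite_component (geometric_graph (P lam' w) (2 * r))}].
  move=> t0; have [_ [lam' [lam'0 perc'] <-] lt'] := lb_ereal_inf_adherent t0 Lc_fin.
  by exists lam'; split => //; rewrite -lte_fin EFinD -LcE.
(* With [eta] arbitrary, this yields both the finiteness of [mu_c] above [lc] and a quotient tending
   to 0. *)
have bound eta : 0 < eta -> exists2 delta0, 0 < delta0 &
    forall delta, 0 < delta -> delta < delta0 ->
    0 < delta ^- (2 * d) * `|ln delta| /\
    (mu_c Pr P Q r (lc + delta) <= (eta * (delta ^- (2 * d) * `|ln delta|))%:E)%E.
  move=> eta0; have [delta0 delta00 par] := admissible_scales hr lc0 eta0 d0.
  exists (Num.min delta0 1); first by rewrite lt_min delta00 ltr01.
  move=> delta delta_gt0; rewrite lt_min => /andP[lt_delta0 lt1].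
  have pos : 0 < delta ^- (2 * d) * `|ln delta|.
    by rewrite mulr_gt0 ?invr_gt0 ?exprn_gt0// normr_gt0 ln_eq0// lt_eqF.
  split => //.
  have delta2 : 0 < delta / 2 by rewrite divr_gt0.
  have [lam' [lam'0 lam'lt perc']] := adherent _ delta2.
  have [eps [a [L [eps0 a0 le_r aL [lam_lt le_q]]]]] := par _ _ delta_gt0 lt_delta0 lam'0 lam'lt.
  have lam0 : 0 < lc + delta by rewrite ltr_wpDl.
  have mu0 : 0 < eta * (delta ^- (2 * d) * `|ln delta|) by rewrite mulr_gt0.
  exact: (mu_c_le d0 lam'0 mu0 eps0 a0 (ltW hr) (hP _ lam0) (hP _ lam'0) (hQ _ mu0)
    (hPQ _ _ lam0 mu0) perc' le_r aL lam_lt le_q).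
split.
  apply/eqP; rewrite eq_le; apply/andP; split.
    have [delta0 delta00 bd] := bound 1 ltr01.
    apply/lee_addgt0Pr => e e0; rewrite LcE -EFinD.
    pose delta := Num.min e (delta0 / 2).
    have dl0 : 0 < delta by rewrite lt_min e0 divr_gt0.
    have dl1 : delta < delta0.
      apply: le_lt_trans (_ : delta0 / 2 < _); last by lra.
      by rewrite ge_min lexx orbT.
    have [_ mu_le] := bd _ dl0 dl1.
    apply: (@le_trans _ _ (lc + delta)%:E).
      apply: ereal_inf_lbound; exists (lc + delta) => //.
      by split; [rewrite ltr_wpDl|apply: le_lt_trans mu_le (ltry _)].
    by rewrite lee_fin lerD2l ge_min lexx.
  (* If [mu_c] is finite at [lam], some bipartite graph percolates almost surely, and then so does
     the geometric graph at range [2 * r]. *)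
  apply: le_ereal_inf => _ [lam [lam0 mu_lty] <-]; exists lam => //; split => //.
  have [_ [mu [mu0 perc] <-] _] := ereal_inf_lt mu_lty.
  apply: filterS perc => w; apply: geometric_of_bipartite.
  exact: (pp_locally_finite (hQ _ mu0)).
(* The stated constant is nonnegative, so it is enough that the upper limit is at most every
   [eta > 0]. *)
rewrite -/lc /=; apply: (@le_trans _ _ 0%E); last first.
  rewrite lee_fin mulr_ge0//; last by rewrite fine_ge0// volume_ge0.
  by rewrite !mulr_ge0// exprn_ge0// divr_ge0 ?(ltW hr)// mulr_ge0// sqr_ge0.
apply/lee_addgt0Pr => eta eta0; rewrite add0e.
have [delta0 delta00 bd] := bound eta eta0.
apply: (@le_trans _ _ (ereal_sup ((fun delta : R =>
    mu_c Pr P Q r (lc + delta)%R / (delta ^- (2 * d) * `|ln delta|)%R%:E)%E @`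
    [set delta | 0 < delta < delta0]))).
  apply: ereal_inf_lbound; exists [set delta | 0 < delta < delta0] => //.
  near=> delta; apply/andP; split; near: delta.
    exact: nbhs_right_gt.
  exact: nbhs_right_lt.
apply: ge_ereal_sup => _ [delta /andP[dl0 dl1] <-].
have [pos mu_le] := bd _ dl0 dl1.
by rewrite inver gt_eqF// lee_pdivrMr// -EFinM.
Unshelve. all: by end_near.
Qed.
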